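(* Let $\mathcal{F}\in\{\mathcal{A},\mathcal{S}\}$ and let $n,k$ be positive integers. Then \[\zeta_{\mathcal{F}_n}(k)=(-1)^k\sum_{l=1}^{n-1}\binom{k+l-1}{l}\mathfrak{Z}_{\mathcal{F}_n}(k+l)\,x_{\mathcal{F}_n}^l.\]
   Context: For $n\ge1$ let $\mathcal{A}_n=\prod_p\mathbb{Z}/p^n\mathbb{Z}\big/\bigoplus_p\mathbb{Z}/p^n\mathbb{Z}$ ($p$ over all primes) and $\zeta_{\mathcal{A}_n}(k)=\bigl(\sum_{m=1}^{p-1}m^{-k}\bmod p^n\bigr)_p$. Let $\mathcal{Z}\subset\mathbb{R}$ be the $\mathbb{Q}$-algebra generated by all multiple zeta values $\zeta(k_1,\dots,k_r)=\sum_{0<m_1<\cdots<m_r}m_1^{-k_1}\cdots m_r^{-k_r}$ ($k_r\ge2$), and $\overline{\mathcal{Z}}=\mathcal{Z}/\zeta(2)\mathcal{Z}$. For an index (tuple of positive integers) $\boldsymbol{k}=(k_1,\dots,k_r)$ and $\bullet\in\{*,\text{sh}\}$ let $\zeta^\bullet(\boldsymbol{k})$ be the harmonic (stuffle), resp. shuffle, regularized multiple zeta value (unique extension compatible with the corresponding product, with $\zeta^\bullet(1)=0$, $\zeta^\bullet(\varnothing)=1$). Set $\zeta^\bullet_{\widehat{\mathcal{S}}}(\boldsymbol{k})=\sum_{i=0}^r(-1)^{k_{i+1}+\cdots+k_r}\zeta^\bullet(k_1,\dots,k_i)\sum_{l_{i+1},\dots,l_r\ge0}\Bigl[\prod_{j=i+1}^r\binom{k_j+l_j-1}{l_j}\Bigr]\zeta^\bullet(k_r+l_r,\dots,k_{i+1}+l_{i+1})t^{l_{i+1}+\cdots+l_r}$;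 its image in $\overline{\mathcal{Z}}[[t]]$ is independent of $\bullet$, and $\zeta_{\mathcal{S}_n}(\boldsymbol{k})$ is its image in $\overline{\mathcal{Z}}[[t]]/(t^n)$. Put $x_{\mathcal{A}_n}=(p\bmod p^n)_p$, $x_{\mathcal{S}_n}=t\bmod t^n$; $\mathfrak{Z}_{\mathcal{A}_n}(k)=\bigl(\frac{B_{p^{n-1}(p-1)-k+1}}{k-1+p^{n-1}}\bmod p^n\bigr)_p$ ($B_j$ Bernoulli numbers), and $\mathfrak{Z}_{\mathcal{S}_n}(k)=\zeta(k)\bmod\zeta(2)$ viewed as a constant in $\overline{\mathcal{Z}}[[t]]/(t^n)$ ($k\ge2$). *)

(* Defs.v *)
From HB Require Import structures.
From mathcomp Require Import all_boot all_order all_algebra.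
From mathcomp Require Import generic_quotient ring_quotient.
From mathcomp Require Import all_classical all_reals all_analysis.

Set Implicit Arguments.
Unset Strict Implicit.
Unset Printing Implicit Defensive.

Import Order.TTheory GRing.Theory Num.Theory.
Import numFieldNormedType.Exports.

Local Open Scope classical_set_scope.
Local Open Scope ring_scope.
Local Open Scope quotient_scope.

(* The ideals of ring_quotient are proper, but it is not known whether
   zeta(2) is a unit of the algebra of multiple zeta values: quotients by
   possibly improper ideals are built here, with values in comPzRingType. *)
HB.mixin Record isMulIdeal (K : comPzRingType) (S : K -> bool) := {
  ideal_mull_subproof : forall a, {in S, forall u, a * u \in S}
}.

#[short(type="ideal")]
HB.structure Definition Ideal (K : comPzRingType) :=
  {S of GRing.ZmodClosed K S & isMulIdeal K S}.

Definition ring_quot (K : comPzRingType) (I : ideal K) : Type :=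
  Quotient.quot (I : zmodClosed K).

Section RingQuot.
Variables (K : comPzRingType) (I : ideal K).
Local Notation Q := (ring_quot I).

HB.instance Definition _ := EqQuotient.on Q.
HB.instance Definition _ := GRing.Zmodule.on Q.
HB.instance Definition _ := ZmodQuotient.on Q.

Lemma idealMl (a u : K) : u \in I -> a * u \in I.
Proof. exact: ideal_mull_subproof. Qed.

Lemma ring_quot_eqP (x y : K) :
  reflect (\pi_Q x = \pi_Q y) (x - y \in I).
Proof. by rewrite (Quotient.idealrBE (I : zmodClosed K)); apply: eqP. Qed.

Definition ring_quot_one : Q := \pi_Q 1.
Definition ring_quot_mul (x y : Q) : Q := \pi_Q (repr x * repr y).

Lemma pi_ring_quot_mul (x y : K) :
  \pi_Q (x * y) = ring_quot_mul (\pi_Q x) (\pi_Q y).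
Proof.
apply/ring_quot_eqP; set x' := repr _; set y' := repr _.
have xE : x - x' \in I by apply/ring_quot_eqP; rewrite reprK.
have yE : y - y' \in I by apply/ring_quot_eqP; rewrite reprK.
have -> : x * y - x' * y' = y * (x - x') + x' * (y - y').
  by rewrite !mulrBr [y * x]mulrC [y * x']mulrC addrA subrK.
by rewrite rpredD// idealMl.
Qed.

Lemma ring_quot_mulA : associative ring_quot_mul.
Proof.
elim/quotW=> x; elim/quotW=> y; elim/quotW=> z.
rewrite -(pi_ring_quot_mul y z) -(pi_ring_quot_mul x y).
by rewrite -(pi_ring_quot_mul x) -(pi_ring_quot_mul _ z) mulrA.
Qed.

Lemma ring_quot_mulC : commutative ring_quot_mul.
Proof.
elim/quotW=> x; elim/quotW=> y.
by rewrite -(pi_ring_quot_mul x y) -(pi_ring_quot_mul y x) mulrC.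
Qed.

Lemma ring_quot_mul1 : left_id ring_quot_one ring_quot_mul.
Proof. by elim/quotW=> x; rewrite -(pi_ring_quot_mul 1 x) mul1r. Qed.

Lemma pi_ring_quotD (x y : K) : \pi_Q (x + y) = \pi_Q x + \pi_Q y.
Proof. exact: (@pi_addr _ _ _ _ _ Q). Qed.

Lemma ring_quot_mulDl : left_distributive ring_quot_mul +%R.
Proof.
elim/quotW=> x; elim/quotW=> y; elim/quotW=> z.
rewrite -(pi_ring_quot_mul x z) -(pi_ring_quot_mul y z) -!pi_ring_quotD.
by rewrite -(pi_ring_quot_mul (x + y) z) mulrDl.
Qed.

HB.instance Definition _ := GRing.Zmodule_isComPzRing.Build Q
  ring_quot_mulA ring_quot_mulC ring_quot_mul1 ring_quot_mulDl.

Definition to_quot (x : K) : Q := \pi_Q x.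

Lemma to_quot_is_zmod_morphism : zmod_morphism to_quot.
Proof.
move=> x y; rewrite /to_quot pi_ring_quotD; congr (_ + _).
exact: (@pi_oppr _ _ _ _ _ Q).
Qed.
HB.instance Definition _ :=
  GRing.isZmodMorphism.Build K Q to_quot to_quot_is_zmod_morphism.

Lemma to_quot_is_monoid_morphism : monoid_morphism to_quot.
Proof. by split=> // x y; exact: pi_ring_quot_mul. Qed.
HB.instance Definition _ :=
  GRing.isMonoidMorphism.Build K Q to_quot to_quot_is_monoid_morphism.

Lemma to_quotP (x y : K) :
  reflect (to_quot x = to_quot y) (x - y \in I).
Proof. exact: ring_quot_eqP. Qed.

End RingQuot.

Arguments to_quot {K} I x.

Section PrincipalIdeal.
Variables (K : comPzRingType) (a : K).

Definition principal : {pred K} := fun x => `[< exists b, x = a * b >].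

Lemma principal_zmod_closed : zmod_closed principal.
Proof.
split; first by apply/asboolP; exists 0; rewrite mulr0.
move=> x y /asboolP[b ->] /asboolP[c ->].
by apply/asboolP; exists (b - c); rewrite mulrBr.
Qed.
HB.instance Definition _ :=
  GRing.isZmodClosed.Build K principal principal_zmod_closed.

Lemma principal_mull : forall u, {in principal, forall x, u * x \in principal}.
Proof.
move=> u x /asboolP[b ->]; apply/asboolP.
by exists (u * b); rewrite mulrCA.
Qed.
HB.instance Definition _ := isMulIdeal.Build K principal principal_mull.

End PrincipalIdeal.

Definition fps (K : Type) : Type := nat -> K.

Section FormalPowerSeries.
Variable K : comPzRingType.

HB.instance Definition _ := GRing.Zmodule.copy (fps K) (nat -> K).

Definition fps_const (c : K) : fps K := fun m => if m == 0%N then c else 0.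
Definition fps_X : fps K := fun m => (m == 1%N)%:R.
Definition fps_mul (f g : fps K) : fps K :=
  fun m => \sum_(i < m.+1) f i * g (m - i)%N.

Lemma fps_mulC : commutative fps_mul.
Proof.
move=> f g; apply/funext => m; rewrite /fps_mul (reindex_inj rev_ord_inj) /=.
apply: eq_bigr => i _; rewrite mulrC subSS subKn//.
by rewrite -ltnS.
Qed.

Lemma fps_mul_rev f g m :
  fps_mul f g m = \sum_(i < m.+1) f (m - i)%N * g i.
Proof.
by rewrite fps_mulC /fps_mul; apply: eq_bigr => i _; rewrite mulrC.
Qed.

Lemma fps_mulA : associative fps_mul.
Proof.
move=> f g h; apply/funext => m; rewrite {1}/fps_mul.
pose F j i := f j * (g (m - j - i)%N * h i).
transitivity (\sum_(j < m.+1) \sum_(i < m.+1 | (i <= m - j)%N) F j i).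
  apply: eq_bigr => /= j _; rewrite fps_mul_rev big_distrr /=.
  by rewrite (big_ord_narrow_leq (leq_subr _ _)).
rewrite (exchange_big_dep predT) //=.
rewrite fps_mul_rev; apply: eq_bigr => i _.
transitivity (\sum_(j < m.+1 | (j <= m - i)%N) F j i).
  apply: eq_bigl => j; rewrite -ltnS -(ltnS j) -!subSn ?leq_ord //.
  by rewrite -subn_gt0 -(subn_gt0 j) -!subnDA addnC.
rewrite (big_ord_narrow_leq (leq_subr _ _)) /fps_mul big_distrl /=.
by apply: eq_bigr => j _; rewrite /F -!subnDA addnC mulrA.
Qed.

Lemma fps_mul1 : left_id (fps_const 1) fps_mul.
Proof.
move=> f; apply/funext => m; rewrite /fps_mul big_ord_recl /= mul1r subn0.
by rewrite big1 ?addr0// => i _; rewrite /fps_const /= mul0r.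
Qed.

Lemma fps_mulDl : left_distributive fps_mul +%R.
Proof.
move=> f g h; apply/funext => m.
rewrite -[RHS]/(fps_mul f h m + fps_mul g h m) /fps_mul -big_split.
by apply: eq_bigr => i _; exact: mulrDl.
Qed.

HB.instance Definition _ := GRing.Zmodule_isComPzRing.Build (fps K)
  fps_mulA fps_mulC fps_mul1 fps_mulDl.

End FormalPowerSeries.

Arguments fps_X {K}.

Definition fps_map (K L : Type) (phi : K -> L) (f : fps K) : fps L :=
  fun m => phi (f m).

Definition prime_number : Type := {p : nat | prime p}.

(* 'Z_m is Z/m only for 1 < m, so the exponent n has to be positive. *)
Definition prod_Zpn (n : nat) : Type :=
  forall p : prime_number, 'Z_(val p ^ n).

Section ProductRing.
Variable n : nat.
Implicit Types f g : prod_Zpn n.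

HB.instance Definition _ := gen_eqMixin (prod_Zpn n).
HB.instance Definition _ := gen_choiceMixin (prod_Zpn n).

Definition prod_zero : prod_Zpn n := fun=> 0.
Definition prod_opp f : prod_Zpn n := fun p => - f p.
Definition prod_add f g : prod_Zpn n := fun p => f p + g p.
Definition prod_one : prod_Zpn n := fun=> 1.
Definition prod_mul f g : prod_Zpn n := fun p => f p * g p.

Lemma prod_addA : associative prod_add.
Proof. by move=> f g h; apply: functional_extensionality_dep => p; exact: addrA. Qed.
Lemma prod_addC : commutative prod_add.
Proof. by move=> f g; apply: functional_extensionality_dep => p; exact: addrC. Qed.
Lemma prod_add0 : left_id prod_zero prod_add.
Proof. by move=> f; apply: functional_extensionality_dep => p; exact: add0r. Qed.
Lemma prod_addN : left_inverse prod_zero prod_opp prod_add.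
Proof. by move=> f; apply: functional_extensionality_dep => p; exact: addNr. Qed.
HB.instance Definition _ := GRing.isZmodule.Build (prod_Zpn n)
  prod_addA prod_addC prod_add0 prod_addN.

Lemma prod_mulA : associative prod_mul.
Proof. by move=> f g h; apply: functional_extensionality_dep => p; exact: mulrA. Qed.
Lemma prod_mulC : commutative prod_mul.
Proof. by move=> f g; apply: functional_extensionality_dep => p; exact: mulrC. Qed.
Lemma prod_mul1 : left_id prod_one prod_mul.
Proof. by move=> f; apply: functional_extensionality_dep => p; exact: mul1r. Qed.
Lemma prod_mulDl : left_distributive prod_mul prod_add.
Proof. by move=> f g h; apply: functional_extensionality_dep => p; exact: mulrDl. Qed.
HB.instance Definition _ := GRing.Zmodule_isComPzRing.Build (prod_Zpn n)
  prod_mulA prod_mulC prod_mul1 prod_mulDl.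

Definition directsum_Zpn : {pred prod_Zpn n} :=
  fun f => `[< finite_set [set p | f p != 0] >].

Lemma directsum_zmod_closed : zmod_closed directsum_Zpn.
Proof.
split.
  apply/asboolP; apply: (sub_finite_set _ (@finite_set0 _)).
  by move=> p /eqP[].
move=> f g /asboolP ff /asboolP fg; apply/asboolP.
have : finite_set ([set p | f p != 0] `|` [set p | g p != 0]).
  by rewrite finite_setU.
apply: sub_finite_set => p /= fgp.
case: (eqVneq (f p) 0) => [fp|]; last by left.
right; apply: contraNneq fgp => gp.
by rewrite -[(f - g) p]/(f p - g p) fp gp subr0.
Qed.
HB.instance Definition _ :=
  GRing.isZmodClosed.Build (prod_Zpn n) directsum_Zpn directsum_zmod_closed.

Lemma directsum_mull :
  forall f, {in directsum_Zpn, forall g, f * g \in directsum_Zpn}.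
Proof.
move=> f g /asboolP fg; apply/asboolP; apply: sub_finite_set fg => p /=.
by apply: contraNneq => gp; rewrite -[(f * g) p]/(f p * g p) gp mulr0.
Qed.
HB.instance Definition _ :=
  isMulIdeal.Build (prod_Zpn n) directsum_Zpn directsum_mull.

Definition Aring : comPzRingType := ring_quot (directsum_Zpn : ideal _).

Definition Aclass (f : prod_Zpn n) : Aring :=
  to_quot (directsum_Zpn : ideal _) f.

End ProductRing.

Fixpoint bernoulli_seq (m : nat) : seq rat :=
  if m isn't m'.+1 then [::] else
  let s := bernoulli_seq m' in
  rcons s ((m' == 0%N)%:R - (m'.+1%:R)^-1 * \sum_(i < m') 'C(m'.+1, i)%:R * s`_i).

Definition bernoulli (m : nat) : rat := (bernoulli_seq m.+1)`_m.

Lemma size_bernoulli_seq m : size (bernoulli_seq m) = m.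
Proof. by elim: m => //= m IH; rewrite size_rcons IH. Qed.

Lemma nth_bernoulli_seq m i : (i < m)%N -> (bernoulli_seq m)`_i = bernoulli i.
Proof.
elim: m => // m IH; rewrite ltnS leq_eqVlt => /orP[/eqP -> //|im] /=.
by rewrite nth_rcons size_bernoulli_seq im IH.
Qed.

Lemma bernoulliE m :
  \sum_(i < m.+1) 'C(m.+1, i)%:R * bernoulli i = (m == 0%N)%:R.
Proof.
rewrite big_ord_recr /= /bernoulli /= nth_rcons size_bernoulli_seq ltnn eqxx.
rewrite binSn mulrBr mulrA mulfV ?pnatr_eq0// mul1r.
under [X in _ - X]eq_bigr => i _ do rewrite nth_bernoulli_seq//.
by rewrite addrC subrK; case: m => [|m]; rewrite ?mulr0 ?mulr1.
Qed.

(* m is a unit of 'Z_(p ^ n) for 0 < m < p. *)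
Definition zetaA (n k : nat) : Aring n :=
  Aclass (fun p => \sum_(1 <= m < val p) (m%:R : 'Z_(val p ^ n)) ^- k).

Definition xA (n : nat) : Aring n := Aclass (fun p => (val p)%:R).

(* ratr reduces a rational a / b modulo p ^ n when b is prime to p; this is the
   case, and the subtraction is not truncated, for almost all p as soon as
   1 < n, 1 < k. *)
Definition ZZA (n k : nat) : Aring n :=
  Aclass (fun p =>
    ratr (bernoulli (val p ^ (n - 1) * (val p - 1) + 1 - k)%N
          / (k - 1 + val p ^ (n - 1))%N%:R)).

Definition is_index (k : seq nat) : bool := all (leq 1) k.

Definition admissible (k : seq nat) : bool :=
  is_index k && (1 < last 2 k)%N.

Section MultipleZetaValues.
Variable R : realType.

Definition mzv_partial (k : seq nat) (N : nat) : R :=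
  \sum_(m : (size k).-tuple 'I_N | path ltn 0 [seq val i | i <- m])
    \prod_(j < size k) (tnth m j)%:R ^- nth 0%N k j.

Definition mzv (k : seq nat) : R := lim (mzv_partial k @ \oo).

Definition Q_subalgebra (S : set R) : Prop :=
  [/\ S 1,
      forall x y, S x -> S y -> S (x + y),
      forall x y, S x -> S y -> S (x * y)
    & forall (q : rat) x, S x -> S (ratr q * x)].

Definition mzv_algebra : set R :=
  smallest Q_subalgebra [set mzv k | k in [set k | admissible k]].

Definition mzv_pred : {pred R} := fun x => `[< mzv_algebra x >].

Lemma mzv_subring_closed : subring_closed mzv_pred.
Proof.
have QS S : Q_subalgebra S -> forall x y, S x -> S y -> S (x - y).
  move=> [S1 SD SM SQ] x y Sx Sy; apply: (SD _ _ Sx).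
  by rewrite -mulN1r -(rmorphN1 ratr); apply: SQ.
split.
- by apply/asboolP => S [[S1 _ _ _] _].
- move=> x y /asboolP Ax /asboolP Ay; apply/asboolP => S [/= HS HG].
  by apply: QS => //; [apply: Ax | apply: Ay].
- move=> x y /asboolP Ax /asboolP Ay; apply/asboolP => S [/= HS HG].
  case: (HS) => _ _ SM _.
  by apply: SM; [apply: Ax | apply: Ay].
Qed.
HB.instance Definition _ :=
  GRing.isSubringClosed.Build R mzv_pred mzv_subring_closed.

Definition Zalg : Type := {x : R | x \in mzv_pred}.
HB.instance Definition _ := SubChoice.on Zalg.
HB.instance Definition _ := [SubChoice_isSubComNzRing of Zalg by <:].

Lemma mzv_in_algebra k : admissible k -> mzv k \in mzv_pred.
Proof. by move=> adm; apply/asboolP => S [_]; apply; exists k. Qed.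

(* Meaningful for admissible k only; see val_mzvZ. *)
Definition mzvZ (k : seq nat) : Zalg := insubd (0 : Zalg) (mzv k).

Lemma val_mzvZ k : admissible k -> val (mzvZ k) = mzv k.
Proof. by move=> adm; rewrite insubdK// mzv_in_algebra. Qed.

Definition Zbar : comPzRingType :=
  ring_quot (principal (mzvZ [:: 2%N]) : ideal Zalg).

Definition to_Zbar (x : Zalg) : Zbar := to_quot _ x.

Definition Sring (n : nat) : comPzRingType :=
  ring_quot (principal ((fps_X : fps Zbar) ^+ n) : ideal (fps Zbar)).

Definition Sclass (n : nat) (f : fps Zbar) : Sring n := to_quot _ f.

Definition xS (n : nat) : Sring n := Sclass n fps_X.

Definition ZZS (n k : nat) : Sring n :=
  Sclass n (fps_const (to_Zbar (mzvZ [:: k]))).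

End MultipleZetaValues.

(* The list of the terms, with multiplicities, of the harmonic product of two
   indices. *)
Fixpoint stuffle (u : seq nat) {struct u} : seq nat -> seq (seq nat) :=
  if u isn't a :: u' then fun v => [:: v] else
  fix stuffle_u (v : seq nat) : seq (seq nat) :=
    if v isn't b :: v' then [:: u] else
    map (cons a) (stuffle u' v) ++ map (cons b) (stuffle_u v')
      ++ map (cons (a + b)%N) (stuffle u' v').

Fixpoint shuffle_word (u : seq bool) {struct u} : seq bool -> seq (seq bool) :=
  if u isn't a :: u' then fun v => [:: v] else
  fix shuffle_u (v : seq bool) : seq (seq bool) :=
    if v isn't b :: v' then [:: u] else
    map (cons a) (shuffle_word u' v) ++ map (cons b) (shuffle_u v').

(* (k_1, ..., k_r) is encoded as e1 e0^(k_1 - 1) ... e1 e0^(k_r - 1), with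
   e1 = true standing for dt / (1 - t) and e0 = false for dt / t, the variables
   of the iterated integral increasing from left to right. *)
Definition word_of_index (k : seq nat) : seq bool :=
  flatten [seq true :: nseq a.-1 false | a <- k].

Fixpoint index_of_word (w : seq bool) : seq nat :=
  match w with
  | [::] => [::]
  | true :: w' => (find id w').+1 :: index_of_word w'
  | false :: w' => index_of_word w'
  end.

Lemma word_of_indexK k : is_index k -> index_of_word (word_of_index k) = k.
Proof.
elim: k => //= a k IH /andP[a0 ik]; congr (_ :: _).
  rewrite find_cat has_nseq andbF size_nseq.
  suff -> : find id (word_of_index k) = 0%N by rewrite addn0 prednK.
  by case: (k).
by elim: a.-1 => //=; exact: IH.
Qed.

Definition shuffle (u v : seq nat) : seq (seq nat) :=
  map index_of_word (shuffle_word (word_of_index u) (word_of_index v)).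

Inductive reg_kind := Harmonic | Shuffle.

Definition index_product (b : reg_kind) : seq nat -> seq nat -> seq (seq nat) :=
  match b with Harmonic => stuffle | Shuffle => shuffle end.

(* The defining property of zeta^b, which determines it on all indices; nothing
   is required of lists that contain a zero. *)
Definition regularized_mzv (R : realType) (b : reg_kind)
    (zeta : seq nat -> Zalg R) : Prop :=
  [/\ zeta [::] = 1,
      zeta [:: 1%N] = 0,
      forall k, admissible k -> zeta k = mzvZ R k
    & forall u v, is_index u -> is_index v ->
        zeta u * zeta v = \sum_(w <- index_product b u v) zeta w].

Section SymmetricMZV.
Variables (R : realType) (zeta : seq nat -> Zalg R).

Definition zeta_Shat_inner (k : seq nat) (i : nat) : fps (Zalg R) := fun m =>
  \sum_(l : {ffun 'I_(size k - i) -> 'I_m.+1} | (\sum_j l j)%N == m)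
    ((\prod_(j < size k - i) 'C(nth 0 k (i + j) + l j - 1, l j))%N%:R
      * zeta (rev [seq (nth 0 k (i + j) + l j)%N | j : 'I_(size k - i)])).

Definition zeta_Shat (k : seq nat) : fps (Zalg R) :=
  \sum_(i < (size k).+1)
    fps_const ((-1) ^+ sumn (drop i k) * zeta (take i k))
      * zeta_Shat_inner k i.

Definition zetaS (n : nat) (k : seq nat) : Sring R n :=
  Sclass n (fps_map (@to_Zbar R) (zeta_Shat k)).

End SymmetricMZV.

(* Main.v *)
From HB Require Import structures.
Require Import Defs.
From mathcomp Require Import all_boot all_order all_algebra.
From mathcomp Require Import cyclic finfield.
From mathcomp Require Import all_classical all_reals all_analysis.
From mathcomp Require Import ring lra zify.

(* For the A-part, put s = p^(n-1) (p-1) - k, so that m^(-k) = m^s modulo p^n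
   by Euler's theorem. Faulhaber's formula writes the sum of the m^s, m < p, as
   the sum over l >= 1 of C(s, l-1)/l B_(s+1-l) p^l. For p large, B_j is
   p-integral unless p-1 divides j, and p B_j always is, so the terms with
   l >= n vanish modulo p^n; in the others C(s, l-1) may be replaced by
   C(-k, l-1), and the sign (-1)^(l-1) agrees with (-1)^k because the Bernoulli
   numbers of odd index vanish.

   For the S-part, only the constant term (1 + (-1)^k) zeta(k) has to be shown
   to vanish modulo zeta(2). For k even this follows by induction from
   Williams' identity
     sum_(0 < j < n) zeta(2j) zeta(2n-2j) = (n + 1/2) zeta(2n),
   which is proved on partial sums by partial fractions. *)

Set Implicit Arguments.
Unset Strict Implicit.
Unset Printing Implicit Defensive.

Import Order.TTheory GRing.Theory Num.Theory.
Import numFieldNormedType.Exports.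

Local Open Scope classical_set_scope.
Local Open Scope ring_scope.

(** * Bernoulli numbers *)

Definition bernoulli_poly (m : nat) (x : rat) : rat :=
  \sum_(i < m.+1) 'C(m, i)%:R * bernoulli i * x ^+ (m - i).

(** Both sides are the trinomial coefficient m!/(i! j! (m-i-j)!), read as 0 when i + j > m. *)
Lemma mul_bin_subn m i j : ('C(m, i) * 'C(m - i, j) = 'C(m, j) * 'C(m - j, i))%N.
Proof.
have [ijm|ijm] := leqP (i + j) m; last first.
  have [im|im] := ltnP m i; have [jm|jm] := ltnP m j;
    rewrite ?(bin_small im) ?(bin_small jm) ?muln0 ?mul0n//.
  - by rewrite [X in (_ * X)%N]bin_small ?muln0//; lia.
  - by rewrite [X in (_ * X)%N]bin_small ?muln0//; lia.
  - by rewrite [X in (_ * X)%N]bin_small ?[X in _ = (_ * X)%N]bin_small ?muln0//; lia.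
have im : (i <= m)%N by lia.
have jm : (j <= m)%N by lia.
have f0 : (0 < i`! * j`! * (m - i - j)`!)%N by rewrite !muln_gt0 !fact_gt0.
apply/eqP; rewrite -(eqn_pmul2r f0); apply/eqP.
have := bin_fact im; have := @bin_fact (m - i) j ltac:(lia).
have := bin_fact jm; have := @bin_fact (m - j) i ltac:(lia).
rewrite (_ : m - j - i = m - i - j)%N; last by lia.
move=> E1 E2 E3 E4.
transitivity m`!.
  by rewrite -E4 -E3; ring.
by rewrite -E2 -E1; ring.
Qed.

(** The range is padded with zero terms up to a bound independent of the exponent, so that
    [bernoulli_polyS] can exchange its two sums. *)
Lemma exprD1n_leq (R : comNzRingType) (x : R) n m : (n <= m)%N ->
  (x + 1) ^+ n = \sum_(j < m.+1) 'C(n, j)%:R * x ^+ j.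
Proof.
move=> nm; rewrite addrC exprDn.
rewrite -(big_mkord xpredT (fun j => 'C(n, j)%:R * x ^+ j)) (big_cat_nat (n := n.+1))//=.
rewrite big_mkord [X in _ = _ + X]big1_seq ?addr0; last first.
  by move=> j; rewrite mem_index_iota => /= jn; rewrite bin_small ?mul0r//; lia.
by apply: eq_bigr => j _; rewrite expr1n mul1r -mulr_natl.
Qed.

(** After expanding (x+1)^(m-i) and exchanging sums, the coefficient of C(m,j) x^j is the sum of the
    C(m-j,i) B_i, which the recurrence turns into B_(m-j), plus 1 when j = m-1. *)
Lemma bernoulli_polyS m x :
  bernoulli_poly m (x + 1) = bernoulli_poly m x + m%:R * x ^+ m.-1.
Proof.
have E : bernoulli_poly m (x + 1) =
    \sum_(i < m.+1) \sum_(j < m.+1)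
       'C(m, j)%:R * x ^+ j * ('C(m - j, i)%:R * bernoulli i).
  apply: eq_bigr => i _; rewrite (exprD1n_leq _ (leq_subr i m)) big_distrr /=.
  apply: eq_bigr => j _.
  have /(congr1 (fun z : nat => z%:R : rat)) := mul_bin_subn m i j.
  rewrite !natrM => H.
  transitivity ('C(m, i)%:R * 'C(m - i, j)%:R * (bernoulli i * x ^+ j)); first by ring.
  by rewrite H; ring.
rewrite {}E exchange_big /=.
pose F (n j : nat) := 'C(n, j)%:R * bernoulli j.
have inner n : (n <= m)%N -> \sum_(i < m.+1) F n i = bernoulli n + (n == 1%N)%:R.
  move=> nm; rewrite -(big_mkord xpredT (F n)) (big_cat_nat (n := n.+1))//=.
  rewrite [X in _ + X = _]big1_seq ?addr0; last first.
    by move=> j; rewrite mem_index_iota => /= jn; rewrite /F bin_small ?mul0r//; lia.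
  rewrite big_nat_recr //= /F binn mul1r addrC; congr (_ + _).
  case: n {nm} => [|n]; first by rewrite big_geq.
  by rewrite big_mkord bernoulliE eqSS.
under eq_bigr => j _.
  rewrite -big_distrr /= inner ?leq_subr// mulrDr.
  over.
rewrite big_split /=; congr (_ + _).
  rewrite /bernoulli_poly (reindex_inj rev_ord_inj) /=.
  apply: eq_bigr => -[i im] _ /=; rewrite subSS bin_sub// subKn//; ring.
case: m {F inner} => [|m]; first by rewrite big_ord1 mulr0 mul0r.
rewrite big_ord_recr big_ord_recr /= subnn mulr0 addr0.
rewrite subSnn eqxx mulr1 big1 ?add0r ?binSn//.
move=> [i im] _ /=; rewrite [(_ == 1)%N](_ : _ = false) ?mulr0//; lia.
Qed.

Lemma bernoulli_poly0 m : bernoulli_poly m 0 = bernoulli m.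
Proof.
rewrite /bernoulli_poly big_ord_recr /= binn mul1r subnn mulr1 big1 ?add0r//.
by move=> [i im] _ /=; rewrite expr0n subn_eq0 leqNgt im mulr0.
Qed.

(** Faulhaber's formula: the increments of [bernoulli_poly s.+1] given by [bernoulli_polyS]
    telescope. *)
Lemma sum_expr_bernoulli s N :
  (\sum_(x < N) x ^ s)%N%:R =
  \sum_(l < s.+1) 'C(s, l)%:R / l.+1%:R * bernoulli (s - l) * N%:R ^+ l.+1 :> rat.
Proof.
have tele : bernoulli_poly s.+1 N%:R - bernoulli s.+1 =
    s.+1%:R * (\sum_(x < N) x ^ s)%N%:R.
  elim: N => [|N IH]; first by rewrite big_ord0 bernoulli_poly0 mulr0 subrr.
  rewrite -[N.+1%:R]natr1 bernoulli_polyS big_ord_recr /= natrD mulrDr -IH natrX.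
  by ring.
apply: (@mulfI _ s.+1%:R); first by rewrite pnatr_eq0.
rewrite -tele /bernoulli_poly big_ord_recr /= binn mul1r subnn mulr1 addrK.
rewrite (reindex_inj rev_ord_inj) big_distrr /=; apply: eq_bigr => -[l ls] _ /=.
rewrite (_ : (s.+1 - (s.+1 - l.+1) = l.+1)%N); last by lia.
rewrite bin_sub// subSS.
have l0 : l.+1%:R != 0 :> rat by rewrite pnatr_eq0.
have /(congr1 (fun z : nat => z%:R : rat)) := mul_bin_diag s.+1 l.
rewrite !natrM => H.
have -> : 'C(s.+1, l.+1)%:R = s.+1%:R * 'C(s, l)%:R / l.+1%:R :> rat.
  by rewrite H mulrC mulKf.
by ring.
Qed.

(* For m even, comparing bernoulli_poly m at 1 and at -1 (both are known from
   its value at 0) leaves only the terms of odd index. *)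
Lemma bernoulli_odd j : odd j -> (1 < j)%N -> bernoulli j = 0.
Proof.
have [n] := ubnP j; elim: n j => // n IH j jn oj j1.
have e1 := bernoulli_polyS j.+1 0.
have e2 := bernoulli_polyS j.+1 (-1).
rewrite addNr bernoulli_poly0 in e2; rewrite add0r bernoulli_poly0 in e1.
have : bernoulli_poly j.+1 1 - bernoulli_poly j.+1 (-1) = - j.+1%:R.
  rewrite e1 e2 /= expr0n -signr_odd oj; have -> : (j == 0%N) = false by lia.
  by rewrite mulr0n expr1; ring.
rewrite /bernoulli_poly -sumrB big_ord_recr/= subnn subrr addr0.
rewrite big_ord_recr/= subSnn !expr1 binSn.
rewrite (bigD1 (Ordinal j1)) //= big1; last first.
  move=> [i ij] /= ; rewrite -val_eqE /= => i1.
  have [oi|ei] := boolP (odd i).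
    by rewrite IH ?mulr0 ?mul0r ?subr0//; lia.
  have ejs : odd (j.+1 - i) = false by rewrite oddB ?leqW ?(ltnW ij)//= oj (negbTE ei).
  by rewrite expr1n -signr_odd ejs expr0 subrr.
rewrite expr1n -signr_odd subn1 /= oj bin1 expr1 addr0.
have -> : bernoulli 1 = - (2%:R)^-1.
  have := bernoulliE 1; have := bernoulliE 0.
  by rewrite !big_ord_recr !big_ord0 /= ?bin0 ?bin1; lra.
(* The term of index 1 equals the right-hand side -(j+1) and cancels it, which leaves 2 (j+1) B_j =
   0. *)
rewrite (_ : _ - _ = - j.+1%:R); last by rewrite mulrN1 opprK; field.
move=> /eqP; rewrite -subr_eq0 [X in X == _](_ : _ = (2 * j.+1)%N%:R * bernoulli j).
  by rewrite mulf_eq0 pnatr_eq0 /= => /eqP.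
by rewrite natrM; ring.
Qed.

(** * Divisibility in the local ring at p *)

(* x lies in p ^ e Z_(p) *)
Definition padic_dvd (p e : nat) (x : rat) : Prop :=
  exists (a : int) (b : nat), ~~ (p %| b)%N /\ x * b%:R = p%:R ^+ e * a%:~R.

Section PadicDivisibility.
Variables (p : nat) (p_prime : prime p).

Lemma padic_dvd_intr e (a : int) : padic_dvd p e (p%:R ^+ e * a%:~R).
Proof.
by exists a, 1%N; rewrite mulr1 Euclid_dvd1.
Qed.

Lemma padic_dvd_nat (a : nat) : padic_dvd p 0 a%:R.
Proof. by have := padic_dvd_intr 0 a; rewrite expr0 mul1r. Qed.

Lemma padic_dvd_expr e : padic_dvd p e (p%:R ^+ e).
Proof. by have := padic_dvd_intr e 1; rewrite mulr1. Qed.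

Lemma padic_dvd0 e : padic_dvd p e 0.
Proof. by have := padic_dvd_intr e 0; rewrite mulr0. Qed.

Lemma padic_dvdD e x y : padic_dvd p e x -> padic_dvd p e y -> padic_dvd p e (x + y).
Proof.
move=> [a [b [pb xb]]] [c [d [pd yd]]].
exists (a * d + c * b), (b * d)%N; split; first by rewrite Euclid_dvdM// negb_or pb.
rewrite natrM mulrDl {1}mulrA xb [b%:R * _]mulrC mulrA yd intrD !intrM -!pmulrn; ring.
Qed.

Lemma padic_dvdM e f x y :
  padic_dvd p e x -> padic_dvd p f y -> padic_dvd p (e + f) (x * y).
Proof.
move=> [a [b [pb xb]]] [c [d [pd yd]]].
exists (a * c), (b * d)%N; split; first by rewrite Euclid_dvdM// negb_or pb.
by rewrite natrM mulrACA xb yd intrM exprD mulrACA.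
Qed.

Lemma padic_dvdN e x : padic_dvd p e x -> padic_dvd p e (- x).
Proof.
move=> [a [b [pb xb]]]; exists (- a), b; split => //.
by rewrite mulNr xb mulrNz mulrN.
Qed.

Lemma padic_dvdB e x y : padic_dvd p e x -> padic_dvd p e y -> padic_dvd p e (x - y).
Proof. by move=> hx hy; apply: padic_dvdD => //; apply: padic_dvdN. Qed.

Lemma padic_dvd_sign e k x : padic_dvd p e x -> padic_dvd p e ((-1) ^+ k * x).
Proof.
move=> hx; rewrite -signr_odd; case: (odd k); rewrite ?expr0 ?expr1 ?mul1r ?mulN1r//.
exact: padic_dvdN.
Qed.

Lemma padic_dvd_sum e (I : Type) (r : seq I) (P : pred I) (F : I -> rat) :
  (forall i, P i -> padic_dvd p e (F i)) -> padic_dvd p e (\sum_(i <- r | P i) F i).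
Proof.
by move=> hF; apply: big_ind => //; [exact: padic_dvd0|exact: padic_dvdD].
Qed.

Lemma padic_dvdW e f x : (f <= e)%N -> padic_dvd p e x -> padic_dvd p f x.
Proof.
move=> fe [a [b [pb xb]]]; exists (p%:Z ^+ (e - f) * a), b; split => //.
by rewrite xb intrM rmorphXn /= mulrA -exprD subnKC.
Qed.

Lemma padic_dvdMl e x y : padic_dvd p 0 x -> padic_dvd p e y -> padic_dvd p e (x * y).
Proof. exact: padic_dvdM. Qed.

Lemma padic_dvdMr e x y : padic_dvd p e x -> padic_dvd p 0 y -> padic_dvd p e (x * y).
Proof. by rewrite -[e in X in _ -> _ -> X]addn0; exact: padic_dvdM. Qed.

Lemma padic_dvd_inv (b : nat) : ~~ (p %| b)%N -> padic_dvd p 0 b%:R^-1.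
Proof.
move=> pb; exists 1, b; split => //; rewrite mulr1 mulVf// pnatr_eq0.
by apply: contraNneq pb => ->.
Qed.

Lemma padic_dvd_pMl e x : padic_dvd p e.+1 (p%:R * x) -> padic_dvd p e x.
Proof.
move=> [a [b [pb xb]]]; exists a, b; split => //.
have p0 : p%:R != 0 :> rat by rewrite pnatr_eq0 -lt0n prime_gt0.
by apply: (mulfI p0); rewrite mulrA xb exprS mulrA.
Qed.

(** Write l = m p^v with m prime to p: the quotient is p^(l-v)/m. The subtraction is exact since v <
    l. *)
Lemma padic_dvd_expr_div l :
  (0 < l)%N -> padic_dvd p (l - logn p l) (p%:R ^+ l / l%:R).
Proof.
move=> l0; have [m pm lE] := pfactor_coprime p_prime l0.
set v := logn p l in lE *.
have vl : (v <= l)%N by apply: ltnW; exact: ltn_logl.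
have pm' : ~~ (p %| m)%N by rewrite -prime_coprime.
have p0 : p%:R != 0 :> rat by rewrite pnatr_eq0 -lt0n prime_gt0.
have -> : p%:R ^+ l / l%:R = m%:R^-1 * p%:R ^+ (l - v) :> rat.
  have {1}-> : p%:R ^+ l = p%:R ^+ (l - v) * p%:R ^+ v :> rat by rewrite -exprD subnK.
  rewrite [X in _ / X%:R]lE natrM natrX invfM mulrACA mulfV ?expf_neq0// mulr1.
  exact: mulrC.
by apply: padic_dvdMl; [exact: padic_dvd_inv|exact: padic_dvd_expr].
Qed.

(** * Reduction of p-integral rationals modulo p^n *)

Section Reduction.
Variables (n : nat) (n_gt0 : (0 < n)%N).
Local Notation Zpn := 'Z_(p ^ n).

Lemma Zpn_gt1 : (1 < p ^ n)%N.
Proof. by rewrite -(exp1n n) ltn_exp2r// prime_gt1. Qed.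

Lemma Zpn_unit b : ~~ (p %| b)%N -> (b%:R : Zpn) \is a GRing.unit.
Proof.
by move=> pb; rewrite unitZpE ?Zpn_gt1// coprimeXl// prime_coprime.
Qed.

Lemma Zpn_expr0 : p%:R ^+ n = 0 :> Zpn.
Proof. by rewrite -natrX pchar_Zp ?Zpn_gt1. Qed.

(** The reduced denominator of x divides b, hence is a unit modulo p^n. This pins [ratr x] down as
    the solution of y b = a, from which compatibility with sums and products of p-integral rationals
    follows. *)
Lemma ratr_Zpn x (a : int) (b : nat) : ~~ (p %| b)%N -> x * b%:R = a%:~R ->
  ratr x * b%:R = a%:~R :> Zpn.
Proof.
move=> pb xb.
have E : numq x * b%:Z = a * denq x.
  by apply: (@intr_inj rat); rewrite !intrM -xb numqE mulrAC.
have den_b : (`|denq x| %| b)%N.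
  have cop : coprime `|denq x| `|numq x| by rewrite coprime_sym coprime_num_den.
  rewrite -(Gauss_dvdr _ cop) -[b]/`|b%:Z|%N -abszM E abszM.
  exact: dvdn_mull.
have pden : ~~ (p %| `|denq x|)%N by apply: contra pb => /dvdn_trans; apply.
have uden : ((denq x)%:~R : Zpn) \is a GRing.unit.
  by rewrite -(gez0_abs (denq_ge0 x)) -pmulrn; exact: Zpn_unit.
rewrite /ratr mulrAC; apply: (mulIr uden); rewrite mulrVK//.
by rewrite -intrM -E intrM.
Qed.

Lemma ratr_ZpnM x y : padic_dvd p 0 x -> padic_dvd p 0 y ->
  ratr (x * y) = ratr x * ratr y :> Zpn.
Proof.
move=> [a [b [pb]]]; rewrite mul1r => xb [c [d [pd]]]; rewrite mul1r => yd.
have pbd : ~~ (p %| b * d)%N by rewrite Euclid_dvdM// negb_or pb.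
apply: (mulIr (Zpn_unit pbd)); rewrite (ratr_Zpn (a := a * c))//; last first.
  by rewrite natrM mulrACA xb yd intrM.
by rewrite natrM mulrACA (ratr_Zpn pb xb) (ratr_Zpn pd yd) intrM.
Qed.

Lemma ratr_ZpnD x y : padic_dvd p 0 x -> padic_dvd p 0 y ->
  ratr (x + y) = ratr x + ratr y :> Zpn.
Proof.
move=> [a [b [pb]]]; rewrite mul1r => xb [c [d [pd]]]; rewrite mul1r => yd.
have pbd : ~~ (p %| b * d)%N by rewrite Euclid_dvdM// negb_or pb.
apply: (mulIr (Zpn_unit pbd)); rewrite (ratr_Zpn (a := a * d + c * b))//; last first.
  rewrite intrD !intrM -xb -yd -!pmulrn natrM; ring.
have := ratr_Zpn pb xb; have := ratr_Zpn pd yd => E1 E2.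
rewrite intrD !intrM -E1 -E2 -!pmulrn natrM; ring.
Qed.

Lemma ratr_Zpn_nat m : ratr m%:R = m%:R :> Zpn.
Proof. by rewrite -[LHS]mulr1 (@ratr_Zpn _ m 1%N) ?mulr1 ?Euclid_dvd1. Qed.

Lemma ratr_Zpn_eq x y : padic_dvd p 0 y -> padic_dvd p n (x - y) ->
  ratr x = ratr y :> Zpn.
Proof.
move=> hy hxy; rewrite -[x](subrK y) ratr_ZpnD//; last exact: padic_dvdW hxy.
rewrite -[RHS]add0r; congr (_ + _).
have [a [b [pb E]]] := hxy; apply: (mulIr (Zpn_unit pb)).
rewrite (@ratr_Zpn _ (p%:Z ^+ n * a))//; last by rewrite E intrM rmorphXn.
by rewrite intrM rmorphXn /= -pmulrn Zpn_expr0 !mul0r.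
Qed.

Lemma ratr_Zpn_sum (I : Type) (r : seq I) (P : pred I) (F : I -> rat) :
  (forall i, P i -> padic_dvd p 0 (F i)) ->
  ratr (\sum_(i <- r | P i) F i) = \sum_(i <- r | P i) ratr (F i) :> Zpn.
Proof.
move=> hF; elim: r => [|i r IH]; first by rewrite !big_nil (ratr_Zpn_nat 0).
rewrite !big_cons; case: ifP => // Pi; rewrite ratr_ZpnD ?IH//; first exact: hF.
exact: padic_dvd_sum.
Qed.

Lemma ratr_Zpn_sign k x : padic_dvd p 0 x ->
  ratr ((-1) ^+ k * x) = (-1) ^+ k * ratr x :> Zpn.
Proof.
move=> hx; rewrite -signr_odd -[in RHS]signr_odd.
case: (odd k); rewrite ?expr0 ?expr1 ?mul1r ?mulN1r//.
apply/eqP; rewrite eq_sym -subr_eq0 -opprD oppr_eq0 -ratr_ZpnD//; last exact: padic_dvdN.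
by rewrite subrr (ratr_Zpn_nat 0).
Qed.

Lemma Zpn_inv_expr m k : ~~ (p %| m)%N -> (k <= p ^ (n - 1) * (p - 1))%N ->
  m%:R ^- k = m%:R ^+ (p ^ (n - 1) * (p - 1) - k) :> Zpn.
Proof.
move=> pm kn; have um := Zpn_unit pm.
apply: (mulIr (unitrX k um)); rewrite mulVr ?unitrX// -exprD subnK//.
have /Euler_exp_totient : coprime m (p ^ n) by rewrite coprime_sym coprimeXl// prime_coprime.
rewrite totient_pfactor// mulnC -!subn1 => H.
apply: esym; rewrite -natrX; transitivity ((m ^ (p ^ (n - 1) * (p - 1)) %% p ^ n)%:R : Zpn).
  by rewrite (Zp_nat_mod Zpn_gt1).
by rewrite H (Zp_nat_mod Zpn_gt1).
Qed.

End Reduction.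
End PadicDivisibility.

(** * Power sums modulo p and denominators of Bernoulli numbers *)

Lemma dvdn_sum_expr p j : prime p -> ~~ (p - 1 %| j)%N -> (p %| \sum_(m < p) m ^ j)%N.
Proof.
move=> pp pj.
have p1 := prime_gt1 pp.
have j0 : (0 < j)%N by case: j pj; rewrite ?dvdn0.
(* If every nonzero x had x^j = 1, then X^r - 1 with r = j mod (p-1), 0 < r < p-1, would have p-1
   roots. *)
have [g g0 gj] : exists2 g : 'F_p, g != 0 & g ^+ j != 1.
  apply/exists_inP; apply: contraNT pj; rewrite negb_exists_in => /forall_inP H.
  have fermat (x : 'F_p) : x != 0 -> x ^+ (p - 1) = 1.
    move=> x0; apply: (mulfI x0); rewrite -exprS mulr1 subn1 prednK ?prime_gt0//.
    by have := expf_card x; rewrite card_Fp.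
  set r := (j %% (p - 1))%N.
  have rp : (r < p - 1)%N by rewrite ltn_mod subn_gt0.
  have Hr (x : 'F_p) : x != 0 -> x ^+ r = 1.
    move=> x0; have := H x x0; rewrite negbK => /eqP.
    by rewrite (divn_eq j (p - 1)) exprD mulnC exprM fermat// expr1n mul1r.
  rewrite /dvdn -/r -leqn0 leqNgt; apply/negP => r0.
  have q0 : ('X^r - 1 : {poly 'F_p}) != 0 by rewrite -size_poly_gt0 size_XnsubC.
  have := @max_poly_roots _ _ (enum [pred x : 'F_p | x != 0]) q0.
  rewrite -cardE enum_uniq size_XnsubC// => /(_ _ isT).
  have -> : #|[pred x : 'F_p | x != 0]| = (p - 1)%N.
    by have := cardC1 (0 : 'F_p); rewrite card_Fp// subn1 => <-; apply: eq_card => x; rewrite !inE.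
  rewrite ltnS leqNgt rp => H'; suff : false by []; apply: H'.
  apply/allP => x; rewrite mem_enum inE => x0.
  by rewrite rootE !hornerE Hr// subrr.
rewrite (dvdn_pcharf (pchar_Fp pp)).
have -> : (\sum_(m < p) m ^ j)%:R = \sum_(x : 'F_p) x ^+ j.
  rewrite natr_sum -(big_mkord xpredT (fun m => (m ^ j)%N%:R)).
  have -> : \sum_(0 <= m < p) (m ^ j)%:R =
      \sum_(0 <= m < (Zp_trunc (pdiv p)).+2) ((m ^ j)%:R : 'F_p) by rewrite [X in _ = \sum_(0 <= m < X) _]Fp_cast.
  rewrite big_mkord; apply: eq_bigr => x _.
  by rewrite natrX natr_Zp.
(* Multiplication by g permutes F_p, so g^j S = S, and S = 0 as g^j is not 1. *)
set S := \sum_x _.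
have : g ^+ j * S = S.
  rewrite /S [RHS](reindex_inj (mulfI g0)) big_distrr /=.
  by apply: eq_bigr => x _; rewrite exprMn.
move=> /eqP; rewrite -subr_eq0 -{2}[S]mul1r -mulrBl mulf_eq0 subr_eq0 (negbTE gj).
by [].
Qed.

Section BernoulliDenominators.
Variables (p : nat) (p_prime : prime p) (p_gt2 : (2 < p)%N).

(** Otherwise p^l would divide l+1, but p^l >= 3^l > l+1. For p = 2 the bound fails at l = 1. *)
Lemma ltn_logn_succ l : (0 < l)%N -> (logn p l.+1 < l)%N.
Proof.
move=> l0; rewrite ltnNge; apply/negP => lv.
have d : (p ^ l %| l.+1)%N by rewrite pfactor_dvdn.
have := dvdn_leq (ltn0Sn _) d; apply/negP; rewrite -ltnNge.
have : (3 ^ l <= p ^ l)%N by rewrite leq_exp2r.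
apply: leq_trans; case: l l0 {lv d} => // l _; elim: l => // l IH.
by rewrite expnS; lia.
Qed.

(** Von Staudt's congruence: in Faulhaber's formula at N = p the leading term is p B_j, and the
    others are controlled by the p-integrality of p B_i for i < j. Hence both claims go through one
    strong induction. *)
Lemma padic_dvd_mul_bernoulli j : padic_dvd p 0 (p%:R * bernoulli j) /\
  (padic_dvd p 1 (p%:R * bernoulli j - (\sum_(m < p) m ^ j)%N%:R)).
Proof.
have [n] := ubnP j; elim: n j => // n IH j jn.
have E : p%:R * bernoulli j - (\sum_(m < p) m ^ j)%N%:R =
   - (\sum_(l < j) 'C(j, l.+1)%:R * (p%:R * bernoulli (j - l.+1)) *
         (p%:R ^+ l.+1 / l.+2%:R)).
  rewrite sum_expr_bernoulli big_ord_recl /= bin0 subn0 divr1 mul1r expr1.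
  rewrite opprD addrA [p%:R * _]mulrC subrr add0r; congr (- _).
  by apply: eq_bigr => l _; rewrite [in LHS]exprS /bump /= add1n; ring.
have main : padic_dvd p 1 (p%:R * bernoulli j - (\sum_(m < p) m ^ j)%N%:R).
  rewrite E; apply: padic_dvdN => //; apply: padic_dvd_sum => // -[l lj] _ /=.
  apply: padic_dvdMl => //.
    apply: padic_dvdMl => //; first exact: padic_dvd_nat.
    by apply: (IH _ _).1; lia.
  (* By [ltn_logn_succ], v_p(l+2) <= l, so p^(l+2)/(l+2) lies in p^2 Z_(p); one p is divided out. *)
  apply: padic_dvd_pMl => //; rewrite mulrA -exprS.
  apply: padic_dvdW (padic_dvd_expr_div p_prime (ltn0Sn l.+1)) => //.
  by have := @ltn_logn_succ l.+1 isT; lia.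
split=> //; rewrite -[_ * _](subrK ((\sum_(m < p) m ^ j)%N%:R)).
by apply: padic_dvdD => //; [exact: padic_dvdW main|exact: padic_dvd_nat].
Qed.

(** Since p-1 does not divide j, the power sum congruent to p B_j is itself divisible by p. *)
Lemma padic_dvd_bernoulli j : ~~ (p - 1 %| j)%N -> padic_dvd p 0 (bernoulli j).
Proof.
move=> pj; apply: padic_dvd_pMl => //.
have [_ H] := padic_dvd_mul_bernoulli j.
rewrite -[_ * _](subrK ((\sum_(m < p) m ^ j)%N%:R)); apply: padic_dvdD => //.
have /dvdnP[q ->] := dvdn_sum_expr p_prime pj.
by have := padic_dvd_intr p_prime 1 q; rewrite -pmulrn natrM expr1 mulrC.
Qed.

End BernoulliDenominators.

(** * Power sums modulo p^n *)

(** Modulo p^e each factor phi-k-i is -(k+i), and [(k + l - 1) ^_ l] is the rising product k (k+1)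
    ... (k+l-1). *)
Lemma padic_dvd_ffact p e phi k l : prime p -> padic_dvd p e phi%:R -> (0 < k)%N ->
  (k + l <= phi)%N ->
  padic_dvd p e (((phi - k) ^_ l)%:R - (-1) ^+ l * ((k + l - 1) ^_ l)%:R).
Proof.
move=> pp hphi k0; elim: l => [|l IH] kl.
  by rewrite !ffactn0 expr0 mul1r subrr; exact: padic_dvd0.
have -> : (k + l.+1 - 1 = (k + l - 1).+1)%N by lia.
rewrite ffactnSr ffactSS !natrM.
have -> : (phi - k - l)%:R = phi%:R - (k + l)%:R :> rat by rewrite -natrB ?subnDA//; lia.
have -> : ((k + l - 1).+1 = k + l)%N by lia.
rewrite [X in padic_dvd _ _ X](_ : _ = ((phi - k) ^_ l)%:R * phi%:R - (k + l)%:R *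
   (((phi - k) ^_ l)%:R - (-1) ^+ l * ((k + l - 1) ^_ l)%:R)); last by rewrite exprS; ring.
apply: padic_dvdB => //; apply: padic_dvdMl => //; first exact: padic_dvd_nat.
  exact: padic_dvd_nat.
by apply: IH; lia.
Qed.

Lemma prime_ndvd_fact p l : prime p -> (l < p)%N -> ~~ (p %| l`!)%N.
Proof.
move=> pp; elim: l => [|l IH] lp; first by rewrite fact0 Euclid_dvd1.
rewrite factS Euclid_dvdM// negb_or IH; last exact: ltnW.
by rewrite gtnNdvd.
Qed.

(** Divide [padic_dvd_ffact] by l!, which is prime to p since l < p. The subtracted term is
    C(-k,l). *)
Lemma padic_dvd_bin p e phi k l : prime p -> padic_dvd p e phi%:R -> (0 < k)%N ->
  (k + l <= phi)%N -> (l < p)%N ->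
  padic_dvd p e ('C(phi - k, l)%:R - (-1) ^+ l * 'C(k + l - 1, l)%:R).
Proof.
move=> pp hphi k0 kl lp.
have := padic_dvd_ffact pp hphi k0 kl.
rewrite -!bin_ffact !natrM mulrA -mulrBl => H.
have l0 : l`!%:R != 0 :> rat by rewrite pnatr_eq0 -lt0n fact_gt0.
rewrite -[X in padic_dvd _ _ X](mulfK l0); apply: padic_dvdMr => //.
by apply: padic_dvd_inv => //; exact: prime_ndvd_fact.
Qed.

Section PowerSumCongruence.
Variables (p n k : nat).
Hypotheses (p_prime : prime p) (n_gt0 : (0 < n)%N) (k_gt0 : (0 < k)%N).
(** The bound gives k + l < p - 1 for l < n, and 2 n < p for the tail of Faulhaber's formula. *)
Hypothesis p_large : (2 * n + k + 4 <= p)%N.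

Let phi := (p ^ (n - 1) * (p - 1))%N.
Let s := (phi - k)%N.

Let faulhaber_term (l : nat) : rat :=
  'C(s, l)%:R / l.+1%:R * bernoulli (s - l) * p%:R ^+ l.+1.

Let p_le_phi : (p - 1 <= phi)%N.
Proof. by rewrite /phi leq_pmull// expn_gt0 prime_gt0. Qed.

(** Modulo p-1 the index s-l is -(k+l), with 0 < k+l < p-1, so p-1 does not divide it. *)
Let bernoulli_int l : (l < n)%N -> padic_dvd p 0 (bernoulli (s - l)).
Proof.
move=> ln; apply: padic_dvd_bernoulli => //; first by lia.
apply/negP => d; have dphi : (p - 1 %| phi)%N by rewrite dvdn_mull.
have : (p - 1 %| k + l)%N.
  rewrite -(subKn (_ : k + l <= phi))%N; last by lia.
  by apply: dvdn_sub => //; rewrite subnDA.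
by apply/negP; rewrite gtnNdvd//; lia.
Qed.

(** For l = n-1 the Bernoulli number is p-integral and l+1 = n is prime to p. For l >= n it may cost
    one factor p, so p^(l+1)/(l+1) has to lie in p^(n+1) Z_(p). *)
Let faulhaber_tail l : (n - 1 <= l)%N -> padic_dvd p n (faulhaber_term l).
Proof.
move=> nl; have [ln|ln] := ltnP l n.
  have -> : n = (l.+1 - logn p l.+1)%N.
    by rewrite ltn_log0; lia.
  rewrite /faulhaber_term [X in padic_dvd _ _ X](_ : _ =
     'C(s, l)%:R * bernoulli (s - l) * (p%:R ^+ l.+1 / l.+1%:R)); last by ring.
  apply: padic_dvdMl => //; last exact: padic_dvd_expr_div.
  by apply: padic_dvdMl; [|exact: padic_dvd_nat|exact: bernoulli_int].
apply: padic_dvd_pMl => //.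
rewrite /faulhaber_term [X in padic_dvd _ _ X](_ : _ =
   'C(s, l)%:R * (p%:R * bernoulli (s - l)) * (p%:R ^+ l.+1 / l.+1%:R)); last by ring.
apply: padic_dvdMl => //.
  apply: padic_dvdMl; [by []|exact: padic_dvd_nat|].
  by apply: (padic_dvd_mul_bernoulli _ _ _).1 => //; lia.
apply: padic_dvdW (padic_dvd_expr_div p_prime (ltn0Sn l)) => //.
have [lp|lp] := ltnP l.+1 p; first by rewrite ltn_log0//; lia.
(* With v = v_p(l+1), the chain 2v <= p^v <= l+1 leaves l+1-v >= (l+1)/2 >= p/2 > n. *)
have v2 v : (2 * v <= p ^ v)%N.
  have : (3 ^ v <= p ^ v)%N by case: v => // v; rewrite leq_exp2r//; lia.
  apply: leq_trans; elim: v => // v IHv; rewrite expnS; lia.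
have := v2 (logn p l.+1); have := dvdn_leq (ltn0Sn l) (pfactor_dvdnn p l.+1); lia.
Qed.

(** The summand of index l+1 in the claimed formula, shifted so as to face [faulhaber_term l] with
    the same power of p. *)
Let closed_term (l : nat) : rat :=
  'C(k + l.+1 - 1, l.+1)%:R *
    (bernoulli (phi + 1 - (k + l.+1)) / (k + l.+1 - 1 + p ^ (n - 1))%:R) * p%:R ^+ l.+1.

Let denominator_unit l : (l.+1 < n)%N -> ~~ (p %| k + l.+1 - 1 + p ^ (n - 1))%N.
Proof.
move=> ln; rewrite dvdn_addl; last by rewrite dvdn_exp//; lia.
by rewrite gtnNdvd//; lia.
Qed.

Let quotient_int l : (l.+1 < n)%N -> padic_dvd p 0
  (bernoulli (phi + 1 - (k + l.+1)) / (k + l.+1 - 1 + p ^ (n - 1))%:R).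
Proof.
move=> ln; have -> : (phi + 1 - (k + l.+1) = s - l)%N by lia.
apply: padic_dvdMl => //; first by apply: bernoulli_int; lia.
by apply: padic_dvd_inv => //; exact: denominator_unit.
Qed.

Let closed_int l : (l.+1 < n)%N -> padic_dvd p 0 (closed_term l).
Proof.
move=> ln; apply: padic_dvdMl => //; last by rewrite -natrX; exact: padic_dvd_nat.
by apply: padic_dvdMl => //; [exact: padic_dvd_nat|exact: quotient_int].
Qed.

(** Either s-l is odd and both terms vanish, or k and l have the same parity because phi is even. In
    the latter case C(k+l,l+1) = (k+l)/(l+1) C(k+l-1,l), and (k+l)/(k+l+p^(n-1)) is 1 modulo
    p^(n-1). *)
Let term_congr l : (l.+1 < n)%N ->
  padic_dvd p n (faulhaber_term l - (-1) ^+ k * closed_term l).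
Proof.
move=> ln; rewrite /faulhaber_term /closed_term.
have -> : (phi + 1 - (k + l.+1) = s - l)%N by lia.
have [js_odd|js_even] := boolP (odd (s - l)).
  rewrite bernoulli_odd//; last by lia.
  by rewrite !(mul0r, mulr0) subrr; exact: padic_dvd0.
have phi_even : odd phi = false.
  rewrite /phi oddM oddB ?prime_gt0//=; case: (even_prime p_prime) => [|->]; last by rewrite andbF.
  by lia.
have -> : (-1) ^+ k = (-1) ^+ l :> rat.
  rewrite -signr_odd -[in RHS]signr_odd; congr (_ ^+ nat_of_bool _).
  move: js_even; rewrite /s !oddB ?phi_even; [|lia|lia].
  by case: (odd k); case: (odd l).
have -> : (k + l.+1 - 1 = k + l)%N by lia.
have bl : 'C(k + l, l.+1)%:R = (k + l)%:R * 'C(k + l - 1, l)%:R / l.+1%:R :> rat.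
  have l0 : l.+1%:R != 0 :> rat by rewrite pnatr_eq0.
  by rewrite -natrM subn1 mul_bin_diag natrM mulrC mulKf.
rewrite bl [(k + l + _)%:R]natrD -/s.
set q := (p ^ (n - 1))%N; set D := 'C(k + l - 1, l)%:R.
have u0 : (k + l)%:R + q%:R != 0 :> rat.
  by rewrite -natrD pnatr_eq0; lia.
(* By (k+l)/(k+l+q) = 1 - q/(k+l+q), both inner summands are divisible by q = p^(n-1), and p^(l+1)
   supplies the missing factor p. *)
rewrite [X in padic_dvd _ _ X](_ : _ = bernoulli (s - l) / l.+1%:R * (p%:R ^+ l.+1 *
  (('C(s, l)%:R - (-1) ^+ l * D) + q%:R * ((-1) ^+ l * (D / ((k + l)%:R + q%:R)))))); last first.
  have l0 : l.+1%:R != 0 :> rat by rewrite pnatr_eq0.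
  move: u0 l0; move: ('C(s, l)%:R) (_ ^+ l.+1) (_ ^+ l) (bernoulli _) => c P e' B.
  by move: D (q%:R) ((k + l)%:R) (l.+1%:R) => d q' kl i u0 i0; field; apply/andP.
apply: padic_dvdMl => //.
  apply: padic_dvdMl => //; first by apply: bernoulli_int; lia.
  by apply: padic_dvd_inv => //; rewrite gtnNdvd//; lia.
apply: (@padic_dvdW _ (l.+1 + (n - 1))); first by lia.
apply: padic_dvdM => //; first exact: padic_dvd_expr.
have qd : padic_dvd p (n - 1) q%:R by rewrite natrX; exact: padic_dvd_expr.
apply: padic_dvdD => //.
  apply: padic_dvd_bin => //; [|lia|lia].
  rewrite /phi natrM; apply: padic_dvdMr => //; exact: padic_dvd_nat.
apply: padic_dvdMr => //; apply: padic_dvd_sign => //.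
apply: padic_dvdMl => //; first exact: padic_dvd_nat.
rewrite -natrD; apply: padic_dvd_inv => //.
by have := denominator_unit ln; rewrite (_ : k + l.+1 - 1 = k + l)%N//; lia.
Qed.

Lemma sum_inv_expr_Zpn :
  \sum_(1 <= m < p) (m%:R : 'Z_(p ^ n)) ^- k =
  (-1) ^+ k * \sum_(1 <= l < n) 'C(k + l - 1, l)%:R *
    ratr (bernoulli (p ^ (n - 1) * (p - 1) + 1 - (k + l))
          / (k + l - 1 + p ^ (n - 1))%N%:R) * p%:R ^+ l.
Proof.
have s0 : (0 < s)%N by lia.
have -> : \sum_(1 <= m < p) (m%:R : 'Z_(p ^ n)) ^- k = ratr (\sum_(m < p) m ^ s)%N%:R.
  rewrite ratr_Zpn_nat// natr_sum -(big_mkord xpredT (fun m => (m ^ s)%N%:R)).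
  rewrite big_ltn ?prime_gt0// exp0n// add0r; apply: eq_big_nat => m /andP[m0 mp].
  by rewrite natrX Zpn_inv_expr// ?gtnNdvd//; lia.
have -> : \sum_(1 <= l < n) ('C(k + l - 1, l)%:R : 'Z_(p ^ n)) *
    ratr (bernoulli (p ^ (n - 1) * (p - 1) + 1 - (k + l))
          / (k + l - 1 + p ^ (n - 1))%N%:R) * p%:R ^+ l =
    ratr (\sum_(l < n - 1) closed_term l).
  rewrite ratr_Zpn_sum//; last by move=> -[l ln] _; apply: closed_int => /=; lia.
  rewrite big_add1 subn1 big_mkord; apply: eq_bigr => -[l ln] _ /=.
  have ln' : (l.+1 < n)%N by lia.
  have nat_int m := padic_dvd_nat p_prime m; have q_int := quotient_int ln'.
  have cq_int := padic_dvdMl p_prime (nat_int 'C(k + l.+1 - 1, l.+1)) q_int.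
  rewrite -!subn1 -/phi /closed_term -!natrX.
  by rewrite (ratr_ZpnM p_prime n_gt0 cq_int)// (ratr_ZpnM p_prime n_gt0 _ q_int)// !ratr_Zpn_nat.
have cint : padic_dvd p 0 (\sum_(l < n - 1) closed_term l).
  by apply: padic_dvd_sum => // -[l ln] _; apply: closed_int => /=; lia.
rewrite -ratr_Zpn_sign//; apply: ratr_Zpn_eq => //; first exact: padic_dvd_sign.
rewrite sum_expr_bernoulli -(big_mkord xpredT faulhaber_term).
rewrite (big_cat_nat (n := n - 1))//=; last by lia.
rewrite addrAC big_mkord big_distrr -sumrB /=.
apply: padic_dvdD => //.
  by apply: padic_dvd_sum => // -[l ln] _; apply: term_congr => /=; lia.
rewrite big_nat_cond; apply: padic_dvd_sum => // l /andP[/andP[nl _] _].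
exact: faulhaber_tail.
Qed.

End PowerSumCongruence.

(** * Passage from almost all primes to the ring of the A-part *)

Definition prod_eval (n : nat) (p : prime_number) (f : prod_Zpn n) : 'Z_(val p ^ n) := f p.

Lemma prod_eval_is_zmod_morphism n p : zmod_morphism (@prod_eval n p).
Proof. by []. Qed.
HB.instance Definition _ n p := GRing.isZmodMorphism.Build (prod_Zpn n) 'Z_(val p ^ n)
  (@prod_eval n p) (@prod_eval_is_zmod_morphism n p).

Lemma prod_eval_is_monoid_morphism n p : monoid_morphism (@prod_eval n p).
Proof. by []. Qed.
HB.instance Definition _ n p := GRing.isMonoidMorphism.Build (prod_Zpn n) 'Z_(val p ^ n)
  (@prod_eval n p) (@prod_eval_is_monoid_morphism n p).

Lemma finite_prime_lt (N : nat) : finite_set [set p : prime_number | (val p < N)%N]%classic.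
Proof.
apply: (@finite_preimage _ _ `I_N val); last exact: finite_II.
by move=> p q _ _; exact: val_inj.
Qed.

(** Finitely many primes disappear in the quotient by the direct sum, so p may be taken as large as
    [sum_inv_expr_Zpn] requires. *)
Lemma Aclass_eq n (f g : prod_Zpn n) N :
  (forall p : prime_number, (N <= val p)%N -> f p = g p) -> Aclass f = Aclass g.
Proof.
move=> fg; apply/to_quotP/asboolP; apply: sub_finite_set (finite_prime_lt N) => p /=.
rewrite ltnNge; apply: contra => /fg fgp.
by rewrite -[(f - g) p]/(prod_eval p (f - g)) rmorphB /= /prod_eval fgp subrr.
Qed.

Lemma zetaA_expansion (n k : nat) : (0 < n)%N -> (0 < k)%N ->
  zetaA n k = (-1) ^+ k * \sum_(1 <= l < n)
      'C(k + l - 1, l)%N%:R * ZZA n (k + l)%N * xA n ^+ l.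
Proof.
move=> n0 k0; rewrite /ZZA /xA /Aclass.
under eq_bigr => l _ do rewrite -(rmorph_nat (to_quot _)) -rmorphXn -!rmorphM.
rewrite -rmorph_sum -(rmorphN1 (to_quot _)) -rmorphXn -rmorphM.
apply: (@Aclass_eq _ _ _ (2 * n + k + 4)) => p p_large.
rewrite (sum_inv_expr_Zpn (valP p) n0 k0 p_large) -[RHS]/(prod_eval p _).
rewrite rmorphM rmorphXn rmorphN1 rmorph_sum; congr (_ * _).
by apply: eq_bigr => l _; rewrite !rmorphM rmorphXn rmorph_nat.
Qed.

(** * Williams' identity *)

Section ZetaPartialSums.
Variable R : realType.

Definition zeta_sum (k N : nat) : R := \sum_(1 <= m < N) m%:R ^- k.

Lemma zeta_sumS k N : (0 < N)%N -> zeta_sum k N.+1 = zeta_sum k N + N%:R ^- k.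
Proof. by move=> N0; rewrite /zeta_sum big_nat_recr. Qed.

Lemma zeta_sum_cat k M N : (0 < M)%N -> (M <= N)%N ->
  zeta_sum k N = zeta_sum k M + \sum_(M <= m < N) m%:R ^- k.
Proof. by move=> M0 MN; rewrite /zeta_sum -big_cat_nat. Qed.

Lemma mzv_partial1 k N : mzv_partial R [:: k] N = zeta_sum k N.
Proof.
rewrite /mzv_partial /= (reindex (fun i : 'I_N => [tuple i])) /=; last first.
  apply: onW_bij; exists (fun t : 1.-tuple 'I_N => tnth t ord0) => [i|t]; first by [].
  by apply/eq_from_tnth => i; rewrite (ord1 i) tnth0.
rewrite /zeta_sum big_geq_mkord; apply: eq_big => [i|i _]; first by rewrite andbT.
by rewrite big_ord1.
Qed.

Lemma zeta_sum_le2 k N : (1 < k)%N -> zeta_sum k N <= 2.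
Proof.
(* The bound m^(-k) <= 1/((m-1) m) telescopes. *)
move=> k1; have H M : zeta_sum k M.+2 <= 2 - M.+1%:R^-1.
  elim: M => [|M IH].
    rewrite zeta_sumS// {1}/zeta_sum big_geq// add0r expr1n; lra.
  rewrite zeta_sumS//; apply: (le_trans (lerD IH (_ : _ <= (M.+1%:R * M.+2%:R)^-1))).
    rewrite lef_pV2 ?posrE ?exprn_gt0 ?mulr_gt0 ?ltr0n//.
    apply: (@le_trans _ _ (M.+2%:R ^+ 2)).
      by rewrite expr2 ler_pM2r ?ltr0n// ler_nat.
    by rewrite ler_eXn2l ?ltr1n.
  have a0 : M.+1%:R != 0 :> R by rewrite pnatr_eq0.
  have b0 : M.+2%:R != 0 :> R by rewrite pnatr_eq0.
  rewrite le_eqVlt; apply/orP; left; apply/eqP.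
  move: a0 b0; rewrite -[M.+2%:R]natr1; move: (M.+1%:R) => x a0 b0.
  by field; rewrite a0 b0.
case: N => [|[|N]]; [by rewrite /zeta_sum big_geq|by rewrite /zeta_sum big_geq|].
by apply: le_trans (H N) _; rewrite gerBl invr_ge0.
Qed.

Lemma cvg_mzv k : (1 < k)%N -> zeta_sum k @ \oo --> mzv R [:: k].
Proof.
move=> k1; have -> : mzv R [:: k] = lim (zeta_sum k @ \oo).
  by rewrite /mzv; congr (lim (_ @ \oo)); apply/funext => N; exact: mzv_partial1.
apply: nondecreasing_is_cvgn.
  apply/nondecreasing_seqP => -[|N].
    by rewrite /zeta_sum !big_geq.
  by rewrite [leRHS]zeta_sumS// lerDl invr_ge0 exprn_ge0.
by exists 2 => _ [N _ <-]; exact: zeta_sum_le2.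
Qed.

(** A geometric sum with ratio v/u, used for u = a^2 and v = b^2. *)
Lemma sum_expr_geom (u v : R) n : u != 0 -> v != 0 -> u != v -> (0 < n)%N ->
  \sum_(1 <= j < n) u ^- j * v ^- (n - j) = (u ^- n.-1 - v ^- n.-1) / (v - u).
Proof.
move=> u0 v0 uv; have vu : v - u != 0 by rewrite subr_eq0 eq_sym.
elim: n => // -[_ _|n IH _]; first by rewrite big_geq// !expr0 subrr mul0r.
rewrite big_nat_recr//= (_ : \sum_(1 <= j < n.+1) _ = v^-1 *
    \sum_(1 <= j < n.+1) u ^- j * v ^- (n.+1 - j)); last first.
  rewrite big_distrr; apply: eq_big_nat => j /andP[_ jn] /=.
  have -> : (n.+2 - j = (n.+1 - j).+1)%N by lia.
  by rewrite exprS invfM; ring.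
rewrite IH// subSnn expr1 /= !exprS.
have un : u ^+ n != 0 by rewrite expf_neq0.
have vn : v ^+ n != 0 by rewrite expf_neq0.
by field; rewrite u0 v0 un vn vu.
Qed.

(* The junk value 0^-1 = 0 makes the terms with b = a uniform. *)
Lemma sum_inv_subr a N : (0 < a < N)%N ->
  \sum_(1 <= b < N) (b%:R - a%:R)^-1 = zeta_sum 1 (N - a) - zeta_sum 1 a :> R.
Proof.
move=> /andP[a0 aN].
rewrite (big_cat_nat (n := a))//=; last by lia.
rewrite [X in _ + X]big_ltn// subrr invr0 add0r addrC; congr (_ + _).
  rewrite -{1}[a.+1]add1n big_addn; apply: eq_bigr => b _.
  by rewrite natrD addrK expr1.
rewrite /zeta_sum -sumrN big_nat_rev /=; apply: eq_big_nat => b /andP[b0 ba].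
have -> : (1 + a - b.+1 = a - b)%N by lia.
by rewrite natrB ?(ltnW ba)// expr1 -invrN; congr (_^-1); ring.
Qed.

Lemma sum_inv_addr a N : (0 < a < N)%N ->
  \sum_(1 <= b < N) (b%:R + a%:R)^-1 = zeta_sum 1 (N + a) - zeta_sum 1 a.+1 :> R.
Proof.
move=> /andP[a0 aN].
rewrite (@zeta_sum_cat 1 a.+1 (N + a))//; last by lia.
rewrite addrAC subrr add0r -[a.+1]add1n big_addn addnK.
by apply: eq_bigr => b _; rewrite natrD expr1.
Qed.

Let H1 := zeta_sum 1.

Lemma sum_delta (r : seq nat) a (F : R) : uniq r -> a \in r ->
  \sum_(b <- r) (if b == a then F else 0) = F.
Proof.
move=> ur ar; rewrite (bigD1_seq a)//= eqxx big1 ?addr0// => b /negbTE -> //.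
Qed.

Lemma sum_inv_sqr a N : (0 < a < N)%N ->
  \sum_(1 <= b < N) (b%:R ^+ 2 - a%:R ^+ 2)^-1 =
  (3 / 2 / a%:R - (H1 (N + a) - H1 (N - a))) / (2 * a%:R) :> R.
Proof.
move=> aN; have /andP[a0 a_ltN] := aN.
have an0 : a%:R != 0 :> R by rewrite pnatr_eq0 -lt0n.
(* Partial fractions; at b = a the left side is 0 while -1/(b+a) remains, so 1/(2a) is added back.
   Together with H1 (a+1) - H1 a = 1/a this makes up the 3/(2a). *)
have E b : b \in index_iota 1 N -> (b%:R ^+ 2 - a%:R ^+ 2)^-1 =
    ((b%:R - a%:R)^-1 - (b%:R + a%:R)^-1 + (if b == a then (2 * a%:R)^-1 else 0)) / (2 * a%:R) :> R.
  rewrite mem_index_iota => /andP[b0 _].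
  have ba : b%:R + a%:R != 0 :> R by rewrite -natrD pnatr_eq0; lia.
  have [->|neq] := eqVneq b a; first by rewrite !subrr invr0 add0r -mulr2n mulr_natl addNr mul0r.
  have ba' : b%:R - a%:R != 0 :> R by rewrite subr_eq0 eqr_nat.
  have -> : b%:R ^+ 2 - a%:R ^+ 2 = (b%:R - a%:R) * (b%:R + a%:R) :> R by ring.
  by field; rewrite ba ba' an0.
rewrite (eq_big_seq _ E) -big_distrl big_split sumrB /= sum_inv_subr// sum_inv_addr//.
rewrite sum_delta ?iota_uniq ?mem_index_iota// zeta_sumS// -/H1 expr1.
by field.
Qed.

Lemma zeta_sum_gap a N : (0 < a < N)%N ->
  0 <= H1 (N + a) - H1 (N - a) <= 2 * a%:R / (N - a)%:R.
Proof.
move=> /andP[a0 aN]; rewrite /H1 (@zeta_sum_cat 1 (N - a) (N + a)); [|lia|lia].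
rewrite addrAC subrr add0r; apply/andP; split.
  by apply: sumr_ge0 => m _; rewrite invr_ge0 exprn_ge0.
apply: (@le_trans _ _ (\sum_(N - a <= m < N + a) (N - a)%:R^-1)).
  rewrite big_nat_cond [leRHS]big_nat_cond; apply: ler_sum => m /andP[/andP[Nm _] _].
  by rewrite expr1 lef_pV2 ?posrE ?ltr0n ?ler_nat//; lia.
rewrite sumr_const_nat (_ : N + a - (N - a) = 2 * a)%N; last by lia.
by rewrite -[leLHS]mulr_natl natrM.
Qed.

(** The defect of Williams' identity caused by truncating the sums at N. *)
Let zeta_error n N := \sum_(1 <= a < N) a%:R ^- n.*2.-1 * (H1 (N + a) - H1 (N - a)).

(** The sum over j, taken inside the double sum over a and b, is geometric off the diagonal and
    gives (n-1) a^(-2n) for b = a. *)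
Lemma williams_finite n N : (1 < n)%N ->
  \sum_(1 <= j < n) zeta_sum j.*2 N * zeta_sum (n - j).*2 N =
  (n%:R + 2^-1) * zeta_sum n.*2 N - zeta_error n N.
Proof.
move=> n1.
pose G (a b : nat) : R := (a%:R ^- n.-1.*2 - b%:R ^- n.-1.*2) * (b%:R ^+ 2 - a%:R ^+ 2)^-1.
pose D (a : nat) : R := \sum_(1 <= b < N) (b%:R ^+ 2 - a%:R ^+ 2)^-1.
have natn0 a : a \in index_iota 1 N -> a%:R != 0 :> R.
  by rewrite mem_index_iota pnatr_eq0 -lt0n => /andP[].
have sq (a m : nat) : a%:R ^- m.*2 = (a%:R ^+ 2) ^- m :> R by rewrite -exprM mul2n.
transitivity (\sum_(1 <= a < N) \sum_(1 <= b < N)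
    (G a b + if b == a then (n - 1)%:R * a%:R ^- n.*2 else 0)).
  under eq_bigr => j _ do rewrite big_distrl /=.
  rewrite exchange_big /=; apply: eq_big_seq => a aN.
  under eq_bigr => j _ do rewrite big_distrr /=.
  rewrite exchange_big /=; apply: eq_big_seq => b bN.
  have [->|neq] := eqVneq b a.
    rewrite /G subrr mul0r add0r -[n in (n - 1)%:R * _]/n mulr_natl -sumr_const_nat.
    apply: eq_big_nat => j /andP[_ jn].
    by rewrite !sq -invfM -exprD subnKC// ltnW.
  rewrite addr0 /G !sq -sum_expr_geom ?expf_neq0 ?natn0//; last by lia.
    by apply: eq_bigr => j _; rewrite !sq.
  by rewrite eqrXn2 // eqr_nat eq_sym.
have -> : \sum_(1 <= a < N) \sum_(1 <= b < N)
    (G a b + if b == a then (n - 1)%:R * a%:R ^- n.*2 else 0) =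
    \sum_(1 <= a < N) (2 * a%:R ^- n.-1.*2 * D a + (n - 1)%:R * a%:R ^- n.*2).
  (* By symmetry in a and b, the two halves of [G a b] have the same double sum. *)
  have sumG : \sum_(1 <= a < N) \sum_(1 <= b < N) G a b =
      \sum_(1 <= a < N) 2 * a%:R ^- n.-1.*2 * D a.
    have -> : \sum_(1 <= a < N) \sum_(1 <= b < N) G a b =
        \sum_(1 <= a < N) \sum_(1 <= b < N) a%:R ^- n.-1.*2 * (b%:R ^+ 2 - a%:R ^+ 2)^-1 +
        \sum_(1 <= a < N) \sum_(1 <= b < N) b%:R ^- n.-1.*2 * (a%:R ^+ 2 - b%:R ^+ 2)^-1.
      rewrite -big_split; apply: eq_bigr => a _; rewrite -big_split; apply: eq_bigr => b _ /=.
      by rewrite /G mulrBl -[(a%:R ^+ 2 - _)]opprB invrN mulrN.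
    rewrite [X in _ + X]exchange_big /= -big_split; apply: eq_bigr => a _ /=.
    by rewrite -!big_distrr /= -/(D a); move: (_ ^- _) (D a) => X d; ring.
  rewrite [RHS]big_split -sumG -big_split; apply: eq_big_seq => a aN /=.
  by rewrite big_split /= sum_delta ?iota_uniq.
rewrite /zeta_error /zeta_sum mulr_sumr -sumrB; apply: eq_big_nat => a aN.
(* The 3/(2a) yields 3/2 a^(-2n), which with n-1 from the diagonal makes n + 1/2. *)
rewrite /D sum_inv_sqr//.
have an0 : a%:R != 0 :> R by rewrite natn0 ?mem_index_iota.
have -> : n.*2.-1 = n.-1.*2.+1 by lia.
have -> : n.*2 = n.-1.*2.+2 by lia.
have -> : (n - 1)%:R = n%:R - 1 :> R by rewrite natrB//; lia.
rewrite !exprS.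
have : a%:R ^+ n.-1.*2 != 0 :> R by rewrite expf_neq0.
move: (_ ^+ n.-1.*2) (H1 _) (H1 _) => X h1 h2 X0.
by field; rewrite an0 X0.
Qed.

(** By a^(1-2n) <= a^(-2) and [zeta_sum_gap], each term is at most 2/(a (N-a)) = 2/N (1/a +
    1/(N-a)). *)
Lemma zeta_error_bound n N : (1 < n)%N -> 0 <= zeta_error n N <= 4 * (N%:R^-1 * H1 N).
Proof.
move=> n1; apply/andP; split.
  rewrite /zeta_error big_nat_cond; apply: sumr_ge0 => a /andP[aN _].
  by rewrite mulr_ge0 ?invr_ge0 ?exprn_ge0//; have /andP[] := zeta_sum_gap aN.
apply: (@le_trans _ _ (\sum_(1 <= a < N) 2 * N%:R^-1 * ((N - a)%:R^-1 + a%:R^-1))).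
  rewrite /zeta_error big_nat_cond [leRHS]big_nat_cond.
  apply: ler_sum => a /andP[/andP[a0 aN] _].
  have an0 : a%:R != 0 :> R by rewrite pnatr_eq0 -lt0n.
  have Na0 : (N - a)%:R != 0 :> R by rewrite pnatr_eq0 subn_eq0 -ltnNge.
  have /andP[g0 g1] := @zeta_sum_gap a N ltac:(by rewrite a0 aN).
  apply: (@le_trans _ _ (a%:R ^- 2 * (2 * a%:R / (N - a)%:R))).
    apply: ler_pM => //.
    rewrite lef_pV2 ?posrE ?exprn_gt0 ?ltr0n//.
    by rewrite ler_weXn2l ?ler1n//; lia.
  rewrite le_eqVlt; apply/orP; left; apply/eqP.
  have NE : N%:R = (N - a)%:R + a%:R :> R by rewrite -natrD subnK// ltnW.
  have N0 : (N - a)%:R + a%:R != 0 :> R by rewrite -NE pnatr_eq0; lia.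
  rewrite NE; move: Na0 N0; move: ((N - a)%:R) => y y0 ya0.
  by field; rewrite an0 y0 ya0.
rewrite -big_distrr big_split /= [X in X + _]big_nat_rev /=.
have -> : \sum_(1 <= i < N) (N - (1 + N - i.+1))%:R^-1 = H1 N.
  by apply: eq_big_nat => i /andP[i0 iN]; rewrite expr1; congr (_%:R^-1); lia.
rewrite (_ : \sum_(1 <= i < N) i%:R^-1 = H1 N); last by apply: eq_bigr => i _; rewrite expr1.
by rewrite le_eqVlt; apply/orP; left; apply/eqP; ring.
Qed.

Lemma cvg_zeta_error n : (1 < n)%N -> zeta_error n @ \oo --> 0.
Proof.
move=> n1; have Hc : (fun N => N%:R^-1 * H1 N) @ \oo --> (0 : R).
  rewrite -cvg_shiftS.
  (* After the shift, H1 (N+1)/(N+1) is dominated by a Cesaro mean of the sequence 1/(m+1), which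
     tends to 0. *)
  apply: (@squeeze_cvgr _ _ _ _ (cst 0) (arithmetic_mean (@harmonic R))).
  - near=> N; rewrite /arithmetic_mean /= mulr_ge0 ?invr_ge0 ?ler0n//=; last first.
      by apply: sumr_ge0 => m _; rewrite invr_ge0 exprn_ge0.
    rewrite ler_pM2l ?invr_gt0 ?ltr0n// /H1 /zeta_sum big_add1 /= seriesEnat /=.
    rewrite [leRHS]big_nat_recr//= -[leLHS]addr0; apply: lerD; last by rewrite invr_ge0.
    by apply: ler_sum => m _; rewrite expr1.
  - exact: cvg_cst.
  - by apply: cesaro; exact: cvg_harmonic.
apply: (@squeeze_cvgr _ _ _ _ (cst 0) (fun N => 4 * (N%:R^-1 * H1 N))).
- by near=> N; exact: zeta_error_bound.
- exact: cvg_cst.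
- by rewrite -[X in _ --> X](mulr0 4); apply: cvgM => //; exact: cvg_cst.
Unshelve. all: by end_near.
Qed.

Theorem williams_mzv n : (1 < n)%N ->
  \sum_(1 <= j < n) mzv R [:: j.*2] * mzv R [:: (n - j).*2] =
  (n%:R + 2^-1) * mzv R [:: n.*2].
Proof.
move=> n1.
have cvgS : (fun N => \sum_(1 <= j < n) zeta_sum j.*2 N * zeta_sum (n - j).*2 N) @ \oo -->
    \sum_(1 <= j < n) mzv R [:: j.*2] * mzv R [:: (n - j).*2].
  rewrite big_nat; under eq_fun do rewrite big_nat.
  apply: cvg_big; first exact: add_continuous.
  by move=> j /andP[j0 jn]; apply: cvgM; apply: cvg_mzv; lia.
have cvgE : (fun N => (n%:R + 2^-1) * zeta_sum n.*2 N - zeta_error n N) @ \oo -->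
    (n%:R + 2^-1) * mzv R [:: n.*2] - 0.
  apply: cvgB; last exact: cvg_zeta_error.
  by apply: cvgM; [exact: cvg_cst|apply: cvg_mzv; lia].
rewrite subr0 in cvgE; apply: (cvg_unique _ cvgS _) => //.
rewrite (_ : (fun N => _) = (fun N => (n%:R + 2^-1) * zeta_sum n.*2 N - zeta_error n N)) //.
by apply/funext => N; exact: williams_finite.
Qed.

End ZetaPartialSums.

(** * Symmetric zeta values of depth one *)

Section FormalPowerSeriesCoefficients.
Variable K : comPzRingType.

Definition fps_coef (m : nat) (f : fps K) : K := f m.

Lemma fps_coef_is_zmod_morphism m : zmod_morphism (fps_coef m).
Proof. by []. Qed.
HB.instance Definition _ m := GRing.isZmodMorphism.Build (fps K) K
  (fps_coef m) (fps_coef_is_zmod_morphism m).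

Lemma fps_coef_constM m c (f : fps K) : fps_coef m (fps_const c * f) = c * fps_coef m f.
Proof.
rewrite /fps_coef -[LHS]/(fps_mul (fps_const c) f m) /fps_mul big_ord_recl /= subn0.
by rewrite big1 ?addr0// => i _; rewrite /fps_const /= mul0r.
Qed.

Lemma fps_const_is_zmod_morphism : zmod_morphism (@fps_const K).
Proof.
move=> x y; apply/funext => m; rewrite -[RHS]/(fps_const x m - fps_const y m) /fps_const.
by case: eqP => //; rewrite subr0.
Qed.
HB.instance Definition _ := GRing.isZmodMorphism.Build K (fps K)
  (@fps_const K) fps_const_is_zmod_morphism.

Lemma fps_const_is_monoid_morphism : monoid_morphism (@fps_const K).
Proof.
split=> // x y; apply/funext => m.
rewrite -[RHS]/(fps_coef m (fps_const x * fps_const y)) fps_coef_constM /fps_coef /fps_const.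
by case: eqP => //; rewrite mulr0.
Qed.
HB.instance Definition _ := GRing.isMonoidMorphism.Build K (fps K)
  (@fps_const K) fps_const_is_monoid_morphism.

Lemma fps_coef_XM m (f : fps K) :
  fps_coef m (fps_X * f) = if m is m'.+1 then fps_coef m' f else 0.
Proof.
rewrite /fps_coef -[LHS]/(fps_mul fps_X f m) /fps_mul.
case: m => [|m]; first by rewrite big_ord1 /fps_X /= mul0r.
rewrite !big_ord_recl /fps_X /= mul0r add0r mul1r subSS subn0 big1 ?addr0//.
by move=> i _; rewrite mul0r.
Qed.

Lemma fps_coef_XnM n m (f : fps K) :
  fps_coef m (fps_X ^+ n * f) = if (n <= m)%N then fps_coef (m - n) f else 0.
Proof.
elim: n m => [|n IH] m; first by rewrite expr0 mul1r subn0.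
by rewrite exprS -mulrA fps_coef_XM; case: m => // m; rewrite IH.
Qed.

Lemma fps_coef_Xn n m : fps_coef m (fps_X ^+ n : fps K) = (m == n)%:R.
Proof.
rewrite -[_ ^+ n]mulr1 fps_coef_XnM /fps_coef -[1]/(fps_const 1) /fps_const subn_eq0.
by rewrite eqn_leq andbC; case: (n <= m)%N => //=; case: (m <= n)%N.
Qed.

(** This reduces equality in [Sring] to comparing coefficients below n; the cofactor is f shifted by
    n. *)
Lemma fps_principal_Xn n (f : fps K) :
  (forall m, (m < n)%N -> f m = 0) -> f \in principal ((fps_X : fps K) ^+ n).
Proof.
move=> f0; apply/asboolP; exists (fun m => f (m + n)%N); apply/funext => m.
rewrite -[RHS]/(fps_coef m (fps_X ^+ n * _)) fps_coef_XnM /fps_coef.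
by case: leqP => [nm|/f0 //]; rewrite subnK.
Qed.

End FormalPowerSeriesCoefficients.

(** * Even zeta values modulo zeta(2) and the S-part *)

Section DepthOne.
Variable R : realType.

Lemma ratr_in_mzv q : (ratr q : R) \in @mzv_pred R.
Proof.
apply/asboolP => S [/= [S1 _ _ SQ] _].
by rewrite -[ratr q]mulr1; exact: SQ.
Qed.

Definition ratrZ (q : rat) : Zalg R := Sub (ratr q) (ratr_in_mzv q).

(** In Williams' identity solved for zeta(2j), each product contains the factor zeta(2j-2i), which
    is in the ideal by induction. *)
Lemma even_mzvZ_principal j : (0 < j)%N -> mzvZ R [:: j.*2] \in principal (mzvZ R [:: 2%N]).
Proof.
have [n] := ubnP j; elim: n j => // n IH j jn j0.
have [->|j1] := eqVneq j 1%N; first by apply/asboolP; exists 1; rewrite mulr1.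
have q0 : j%:R + 2^-1 != 0 :> R by rewrite gt_eqF// ltr_wpDl// invr_gt0.
have -> : mzvZ R [:: j.*2] = ratrZ (j%:R + 2^-1)^-1 *
    \sum_(1 <= i < j) mzvZ R [:: i.*2] * mzvZ R [:: (j - i).*2].
  have valM (x y : Zalg R) : val (x * y) = val x * val y by exact: rmorphM.
  have valD (x y : Zalg R) : val (x + y) = val x + val y by exact: rmorphD.
  apply: val_inj; rewrite valM (big_morph _ valD (rmorph0 val)) val_mzvZ; last first.
    by rewrite /admissible /=; lia.
  under eq_big_nat => i /andP[i0 ij].
    rewrite valM !val_mzvZ; [|by rewrite /admissible /=; lia..].
    over.
  rewrite williams_mzv; last by lia.
  by rewrite -[val (ratrZ _)]/(ratr _) fmorphV rmorphD rmorph_nat fmorphV rmorph_nat mulrA mulVf// mul1r.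
apply: (idealMl (I := principal (mzvZ R [:: 2%N]) : ideal (Zalg R))).
rewrite big_nat; apply: rpred_sum => i /andP[i0 ij].
apply: (idealMl (I := principal (mzvZ R [:: 2%N]) : ideal (Zalg R))).
by apply: IH; lia.
Qed.

Lemma to_Zbar_even k : ~~ odd k -> (0 < k)%N -> to_Zbar (mzvZ R [:: k]) = 0.
Proof.
move=> ek k0; rewrite -(rmorph0 (to_quot (principal (mzvZ R [:: 2%N]) : ideal (Zalg R)))).
apply/to_quotP; rewrite subr0 -[k]odd_double_half (negbTE ek).
by apply: even_mzvZ_principal; lia.
Qed.

Variable zeta : seq nat -> Zalg R.

Lemma zeta_Shat1 k m : zeta [::] = 1 ->
  zeta_Shat zeta [:: k] m =
  (-1) ^+ k * ('C(k + m - 1, m)%:R * zeta [:: (k + m)%N]) + (m == 0%N)%:R * zeta [:: k].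
Proof.
move=> z0; rewrite -[LHS]/(fps_coef m _) /zeta_Shat raddf_sum /= !big_ord_recl big_ord0 /= addr0.
rewrite !fps_coef_constM /= z0 mulr1 mul1r addn0; congr (_ * _ + _).
  rewrite /fps_coef /zeta_Shat_inner /=.
  (* For i = 0 a single exponent occurs, and the condition on the total forces it to be m, the top
     element of its range. *)
  rewrite (big_pred1 [ffun => ord_max]); last first.
    move=> l; rewrite big_ord1 /=; apply/eqP/eqP => [lm|->]; last by rewrite ffunE.
    by apply/ffunP => i; rewrite ffunE (ord1 i); apply/val_inj.
  rewrite big_ord1 ffunE /=; congr (_ * zeta _).
  by rewrite /image_mem enum_ordSl enum_ord0 /= ffunE.
rewrite mulrC; congr (_ * _).
rewrite /fps_coef /zeta_Shat_inner /=.
(* For i = 1 no exponent is left: the total is 0, so only the constant coefficient survives. *)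
rewrite (eq_bigl (fun=> m == 0%N)); last by move=> l; rewrite big_ord0 eq_sym.
case: (m == 0%N); last by rewrite big_pred0_eq.
rewrite (big_pred1 [ffun => ord_max]); last first.
  by move=> l; apply/esym/eqP/ffunP => -[].
by rewrite big_ord0 mul1r /image_mem enum_ord0.
Qed.

Lemma zetaS_expansion b n k : regularized_mzv b zeta -> (0 < k)%N ->
  zetaS zeta n [:: k] =
  (-1) ^+ k * \sum_(1 <= l < n) 'C(k + l - 1, l)%N%:R * ZZS R n (k + l)%N * xS R n ^+ l.
Proof.
move=> [z0 z1 zadm _] k0; rewrite /ZZS /xS /Sclass.
pose c l := to_Zbar (mzvZ R [:: (k + l)%N]).
under eq_bigr => l _ do rewrite -(rmorph_nat (to_quot _)) -rmorphXn -!rmorphM.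
rewrite -rmorph_sum -(rmorphN1 (to_quot _)) -rmorphXn -rmorphM.
apply/to_quotP/fps_principal_Xn => m mn.
rewrite -[LHS]/(fps_coef m _) raddfB /=; apply/eqP; rewrite subr_eq0; apply/eqP.
have -> : (-1) ^+ k = fps_const ((-1) ^+ k) :> fps (Zbar R) by rewrite rmorphXn rmorphN1.
rewrite fps_coef_constM raddf_sum /=.
under eq_bigr => l _ do
  rewrite -(rmorph_nat (@fps_const (Zbar R))) -rmorphM fps_coef_constM fps_coef_Xn.
rewrite /fps_coef /fps_map zeta_Shat1//.
have toZD (x y : Zalg R) : to_Zbar (x + y) = to_Zbar x + to_Zbar y by exact: rmorphD.
have toZM (x y : Zalg R) : to_Zbar (x * y) = to_Zbar x * to_Zbar y by exact: rmorphM.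
have toZn m' : to_Zbar (m'%:R : Zalg R) = m'%:R by exact: rmorph_nat.
have toZs m' : to_Zbar ((-1) ^+ m' : Zalg R) = (-1) ^+ m' by rewrite /to_Zbar rmorphXn rmorphN1.
rewrite toZD !toZM !toZn toZs.
have [m0|m0] := eqVneq m 0%N.
  rewrite {m mn}m0 addn0 bin0 !mul1r.
  rewrite big_nat big1 ?mulr0; last by move=> l /andP[l0 _]; rewrite (ltn_eqF l0) mulr0.
  (* For k odd the two terms cancel, which covers k = 1; for k even each is zero modulo zeta(2). *)
  have [ok|ek] := boolP (odd k); first by rewrite -signr_odd ok expr1 mulN1r addNr.
  rewrite zadm; last by rewrite /admissible /=; lia.
  by rewrite to_Zbar_even// mulr0 addr0.
(* Since m > 0, the index k+m is at least 2, so the regularized value is the convergent one. *)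
rewrite mul0r addr0 zadm; last by rewrite /admissible /=; lia.
congr (_ * _); rewrite (bigD1_seq m)/= ?mem_index_iota ?iota_uniq ?lt0n ?m0//.
rewrite eqxx mulr1 big1 ?addr0// => l lm; by rewrite eq_sym (negbTE lm) mulr0.
Qed.

End DepthOne.

Theorem theorem3p2 (R : realType) (n k : nat) (n_gt0 : (0 < n)%N)
    (k_gt0 : (0 < k)%N) :
  zetaA n k =
    (-1) ^+ k * \sum_(1 <= l < n)
      'C(k + l - 1, l)%N%:R * ZZA n (k + l)%N * xA n ^+ l
  /\
  (forall (b : reg_kind) (zeta : seq nat -> Zalg R),
    regularized_mzv b zeta ->
    zetaS zeta n [:: k] =
      (-1) ^+ k * \sum_(1 <= l < n)
        'C(k + l - 1, l)%N%:R * ZZS R n (k + l)%N * xS R n ^+ l).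
Proof.
split; first exact: zetaA_expansion.
by move=> b zeta reg; exact: zetaS_expansion reg k_gt0.
Qed.
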